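(* Let $K$ be a field. The cluster algebra $\mathcal{A}^{\mathrm{prin}}_{\boldsymbol c}(F_4)$ is isomorphic to a trivial family over $K_{\boldsymbol c}$, where each fiber is isomorphic to the corresponding cluster algebra $\mathcal{A}(F_4)$ with trivial coefficients. Since $\operatorname{Spec}(\mathcal{A}(F_4))$ is isomorphic to a regular hypersurface in $\mathbb A^5_K$, the respective result holds for the fibers of $\operatorname{Spec}(\mathcal{A}^{\mathrm{prin}}_{\boldsymbol c}(F_4))$: each fiber is isomorphic to a regular hypersurface in five-dimensional affine space.
   Context: $K$ is an arbitrary field; $\boldsymbol c=(c_1,\ldots,c_4)$ are invertible coefficients (independent variables); $K_{\boldsymbol c}:=K[c_1^{\pm1},\ldots,c_4^{\pm1}]$ and $S:=\operatorname{Spec}(K_{\boldsymbol c})$. The cluster algebra with principal coefficients of finite cluster type $F_4$, $\mathcal{A}^{\mathrm{prin}}_{\boldsymbol c}(F_4)$, is the $K_{\boldsymbol c}$-algebra with the presentation (by Berenstein–Fomin–Zelevinsky, since the seed is acyclic; it may be taken as definition) $K_{\boldsymbol c}[x_1,\ldots,x_4,y_1,\ldots,y_4]/\langle x_1y_1-c_1-x_2,\ x_2y_2-c_2x_1-x_3^2,\ x_3y_3-c_3x_2-x_4,\ x_4y_4-c_4x_3-1\rangle$. The cluster algebra $\mathcal{A}(F_4)$ with trivial coefficients is the $K$-algebra obtained from the same presentation by setting $c_1=c_2=c_3=c_4=1$. Fibers are those of the structure morphism $\operatorname{Spec}(\mathcal{A}^{\mathrm{prin}}_{\boldsymbol c}(F_4))\to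 S$ over closed points $\eta\in S$; they are varieties over the residue field $\kappa(\eta)$, so a fiber being isomorphic to $\mathcal{A}(F_4)$ is understood after base change to $\kappa(\eta)$. A trivial family means $\mathcal{A}^{\mathrm{prin}}_{\boldsymbol c}(F_4)\cong\mathcal{A}(F_4)\otimes_KK_{\boldsymbol c}$ over $K_{\boldsymbol c}$. *)

(* Defs.v *)
From HB Require Import structures.
From mathcomp Require Import all_boot all_order all_algebra.
From mathcomp Require Import ring_quotient.
From mathcomp Require Import boolp.
From mathcomp Require Import mpoly.
From mathcomp Require Import ring.

Set Implicit Arguments.
Unset Strict Implicit.
Unset Printing Implicit Defensive.

Import GRing.Theory.
Local Open Scope ring_scope.
Local Open Scope quotient_scope.

Section Ideals.
Variable R : comPzRingType.
Implicit Types I J S : R -> Prop.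

Definition gen_ideal S (x : R) : Prop :=
  exists n (a s : 'I_n -> R), (forall i, S (s i)) /\ x = \sum_(i < n) a i * s i.

Definition is_ideal I : Prop :=
  [/\ I 0, forall x y, I x -> I y -> I (x + y) & forall a x, I x -> I (a * x)].

Definition is_prime I : Prop :=
  [/\ is_ideal I, ~ I 1 & forall x y, I (x * y) -> I x \/ I y].

Definition is_maximal I : Prop :=
  [/\ is_ideal I, ~ I 1 &
      forall J, is_ideal J -> ~ J 1 -> (forall x, I x -> J x) ->
                forall x, J x -> I x].

Definition noetherian : Prop :=
  forall I, is_ideal I ->
    exists s : seq R, forall x, I x <-> gen_ideal (fun y => y \in s) x.

Definition prime_chain (d : nat) (p : 'I_d.+1 -> R -> Prop) : Prop :=
  (forall i, is_prime (p i)) /\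
  (forall i j : 'I_d.+1, (i < j)%N ->
     (forall x, p i x -> p j x) /\ exists x, p j x /\ ~ p i x).

Definition krull_dim (d : nat) : Prop :=
  (exists p, @prime_chain d p) /\
  (forall e p, @prime_chain e p -> (e <= d)%N).

(* A Noetherian local ring is regular when its maximal ideal is generated by as
   many elements as its Krull dimension. *)
Definition regular_local : Prop :=
  noetherian /\
  exists m : R -> Prop,
    [/\ is_maximal m,
        forall m', is_maximal m' -> forall x, m' x <-> m x &
        exists d, krull_dim d /\
          exists s : d.-tuple R, forall x, m x <-> gen_ideal (fun y => y \in s) x].

Lemma gen_ideal_is_ideal S : is_ideal (gen_ideal S).
Proof.
split.
- by exists 0%N, (fun=> 0), (fun=> 0); split; [case | rewrite big_ord0].
- move=> x y [n [a [s [Ss ->]]]] [m [b [t [St ->]]]].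
  exists (n + m)%N, (fun i => match split i with inl j => a j | inr j => b j end),
    (fun i => match split i with inl j => s j | inr j => t j end).
  split; first by move=> i; case: (split i).
  rewrite big_split_ord /=; congr (_ + _); apply: eq_bigr => i _.
    by case: splitP => j /= e; [rewrite (val_inj e)
      | by have := ltn_ord i; rewrite e ltnNge leq_addr].
  case: splitP => j /= e; last by rewrite (@ord_inj _ i j) //; apply: (@addnI n).
  by have := ltn_ord j; rewrite -e ltnNge leq_addr.
- move=> c x [n [a [s [Ss ->]]]].
  exists n, (fun i => c * a i), s; split=> //.
  by rewrite mulr_sumr; apply: eq_bigr => i _; rewrite mulrA.
Qed.

Lemma gen_ideal_min S I :
  is_ideal I -> (forall x, S x -> I x) -> forall x, gen_ideal S x -> I x.
Proof.
move=> [I0 ID IM] SI x [n [a [s [Ss ->]]]].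
by elim/big_ind: _ => // i _; apply/IM/SI.
Qed.

Lemma gen_ideal_sub S x : S x -> gen_ideal S x.
Proof.
by move=> Sx; exists 1%N, (fun=> 1), (fun=> x); split=> //; rewrite big_ord1 mul1r.
Qed.

End Ideals.

Record prime_ideal (R : comPzRingType) := PrimeIdeal {
  prime_set :> R -> Prop;
  prime_ideal_prime : is_prime prime_set
}.

Section QuotientRing.
Variables (R : comPzRingType) (S : R -> Prop).

Definition gen_pred : {pred R} := fun x => `[< gen_ideal S x >].

Lemma gen_predP x : reflect (gen_ideal S x) (x \in gen_pred).
Proof. exact: asboolP. Qed.

Lemma gen_pred_zmod_closed : zmod_closed gen_pred.
Proof.
have [I0 ID IM] := gen_ideal_is_ideal S.
split; first exact/gen_predP.
move=> x y /gen_predP Ix /gen_predP Iy; apply/gen_predP.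
by rewrite -[- y]mulN1r; apply: ID => //; apply: IM.
Qed.

HB.instance Definition _ := GRing.isZmodClosed.Build R gen_pred gen_pred_zmod_closed.

Definition qring := Quotient.quot gen_pred.
HB.instance Definition _ := GRing.Zmodule.on qring.

Definition qpi : R -> qring := \pi_qring.

Lemma qpiP x y : qpi x = qpi y <-> gen_ideal S (x - y).
Proof.
split=> [/eqP|/gen_predP]; first by rewrite -Quotient.idealrBE => /gen_predP.
by rewrite Quotient.idealrBE => /eqP.
Qed.

Lemma qpi_surj (u : qring) : exists x, u = qpi x.
Proof. by exists (repr u); rewrite /qpi reprK. Qed.

Let one : qring := qpi 1.
Let mul (u v : qring) : qring := qpi (repr u * repr v).

Lemma qpiM x y : mul (qpi x) (qpi y) = qpi (x * y).
Proof.
have [I0 ID IM] := gen_ideal_is_ideal S.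
apply/qpiP.
have /qpiP Ix : qpi (repr (qpi x)) = qpi x by rewrite /qpi reprK.
have /qpiP Iy : qpi (repr (qpi y)) = qpi y by rewrite /qpi reprK.
have -> : repr (qpi x) * repr (qpi y) - x * y =
  repr (qpi y) * (repr (qpi x) - x) + x * (repr (qpi y) - y) by ring.
by apply: ID; apply: IM.
Qed.

Let qpiD x y : qpi x + qpi y = qpi (x + y).
Proof. by rewrite /qpi !piE. Qed.

Let mulA : associative mul.
Proof.
move=> u v w; have [x ->] := qpi_surj u; have [y ->] := qpi_surj v.
by have [z ->] := qpi_surj w; rewrite !qpiM mulrA.
Qed.

Let mulC : commutative mul.
Proof. by move=> u v; rewrite /mul mulrC. Qed.

Let mul1 : left_id one mul.
Proof. by move=> u; have [x ->] := qpi_surj u; rewrite qpiM mul1r. Qed.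

Let mulD : left_distributive mul +%R.
Proof.
move=> u v w; have [x ->] := qpi_surj u; have [y ->] := qpi_surj v.
by have [z ->] := qpi_surj w; rewrite qpiD !qpiM qpiD mulrDl.
Qed.

HB.instance Definition _ := GRing.Zmodule_isComPzRing.Build qring mulA mulC mul1 mulD.

Let qpi_zmod : zmod_morphism qpi.
Proof. by move=> x y; rewrite /qpi !piE. Qed.

Let qpi_monoid : monoid_morphism qpi.
Proof. by split=> // x y; rewrite -qpiM. Qed.

HB.instance Definition _ := GRing.isZmodMorphism.Build R qring qpi qpi_zmod.
HB.instance Definition _ := GRing.isMonoidMorphism.Build R qring qpi qpi_monoid.

Lemma qring_neq0 : ~ gen_ideal S 1 -> (1 : qring) != 0.
Proof.
by move=> I1; apply/eqP; rewrite -(rmorph1 qpi) -(rmorph0 qpi) => /qpiP; rewrite subr0.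
Qed.

End QuotientRing.

Section Localization.
Variables (R : comPzRingType) (p : prime_ideal R).

Definition loc_den := {s : R | `[< ~ p s >]}.
Definition loc_frac := (R * loc_den)%type.
HB.instance Definition _ := Choice.on loc_frac.

Definition loc_eqv (u v : loc_frac) : bool :=
  `[< exists w, ~ p w /\ w * (u.1 * val v.2 - v.1 * val u.2) = 0 >].

Let den_mul (s t : loc_den) : `[< ~ p (val s * val t) >].
Proof.
case: s t => [s ps] [t pt]; apply/asboolP => /= pst; have [_ _ pP] := prime_ideal_prime p.
by case: (pP _ _ pst); apply/asboolP.
Qed.

Let p1 : ~ p 1.
Proof. by have [] := prime_ideal_prime p. Qed.

Let den_1 : `[< ~ p 1 >].
Proof. exact/asboolP. Qed.

Definition denM (s t : loc_den) : loc_den := Sub (val s * val t) (den_mul s t).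
Definition den1 : loc_den := Sub 1 den_1.

Let pM x y : ~ p x -> ~ p y -> ~ p (x * y).
Proof. by move=> px py pxy; have [_ _ /(_ _ _ pxy) []] := prime_ideal_prime p. Qed.

Let denP (s : loc_den) : ~ p (val s).
Proof. by case: s => s ps /=; apply/asboolP. Qed.

Lemma loc_eqv_equiv : equiv_class_of loc_eqv.
Proof.
split=> [u|u v|v u w].
- by apply/asboolP; exists 1; split; [exact: p1 | ring].
- by apply/idP/idP => /asboolP [t [pt e]]; apply/asboolP; exists t; split=> //;
    rewrite -[LHS]opprK -mulrN opprB e oppr0.
- move=> /asboolP [s [ps es]] /asboolP [t [pt et]]; apply/asboolP.
  exists (s * t * val v.2); split; first by apply: pM; [exact: pM | exact: denP].
  have -> : s * t * val v.2 * (u.1 * val w.2 - w.1 * val u.2) =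
    t * val w.2 * (s * (u.1 * val v.2 - v.1 * val u.2)) +
    s * val u.2 * (t * (v.1 * val w.2 - w.1 * val v.2)) by ring.
  by rewrite es et !mulr0 addr0.
Qed.

Canonical loc_equiv := EquivRelPack loc_eqv_equiv.
Canonical loc_encModRel := defaultEncModRel loc_eqv.

Definition localization := {eq_quot loc_eqv}.
HB.instance Definition _ := Choice.on localization.

Definition frac (a : R) (s : loc_den) : localization := \pi_localization (a, s).

Lemma fracP a s b t :
  frac a s = frac b t <-> exists w, ~ p w /\ w * (a * val t - b * val s) = 0.
Proof.
split=> [/eqP|H]; first by rewrite /frac piE => /asboolP.
by apply/eqP; rewrite /frac piE; apply/asboolP.
Qed.

Lemma frac_surj (u : localization) : exists a s, u = frac a s.
Proof. by exists (repr u).1, (repr u).2; rewrite /frac -surjective_pairing reprK. Qed.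

Let repr_frac a s :
  exists w, ~ p w /\ w * ((repr (frac a s)).1 * val s - a * val (repr (frac a s)).2) = 0.
Proof. by apply/fracP; rewrite /frac -surjective_pairing reprK. Qed.

Let zero := frac 0 den1.
Let one := frac 1 den1.
Let add (u v : localization) := let: (a, s) := repr u in let: (b, t) := repr v in
  frac (a * val t + b * val s) (denM s t).
Let opp (u : localization) := let: (a, s) := repr u in frac (- a) s.
Let mul (u v : localization) := let: (a, s) := repr u in let: (b, t) := repr v in
  frac (a * b) (denM s t).

Lemma fracD a s b t :
  add (frac a s) (frac b t) = frac (a * val t + b * val s) (denM s t).
Proof.
rewrite /add; have [w [pw]] := repr_frac a s; have [z [pz]] := repr_frac b t.
case: (repr _) => b' t' /=; case: (repr _) => a' s' /= ez ew.
apply/fracP; exists (w * z); split; first exact: pM.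
rewrite /=.
have -> : w * z * ((a' * val t' + b' * val s') * (val s * val t) -
     (a * val t + b * val s) * (val s' * val t')) =
   z * val t * val t' * (w * (a' * val s - a * val s')) +
   w * val s * val s' * (z * (b' * val t - b * val t')) by ring.
by rewrite ew ez !mulr0 addr0.
Qed.

Lemma fracM a s b t : mul (frac a s) (frac b t) = frac (a * b) (denM s t).
Proof.
rewrite /mul; have [w [pw]] := repr_frac a s; have [z [pz]] := repr_frac b t.
case: (repr _) => b' t' /=; case: (repr _) => a' s' /= ez ew.
apply/fracP; exists (w * z); split; first exact: pM.
rewrite /=.
have -> : w * z * (a' * b' * (val s * val t) - a * b * (val s' * val t')) =
   z * val t * b' * (w * (a' * val s - a * val s')) +
   w * a * val s' * (z * (b' * val t - b * val t')) by ring.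
by rewrite ew ez !mulr0 addr0.
Qed.

Lemma fracN a s : opp (frac a s) = frac (- a) s.
Proof.
rewrite /opp; have [w [pw]] := repr_frac a s; case: (repr _) => a' s' /= e.
apply/fracP; exists w; split=> //.
have -> : w * (- a' * val s - - a * val s') = - (w * (a' * val s - a * val s')) by ring.
by rewrite e oppr0.
Qed.

Let frac_eq a s b t : a * val t = b * val s -> frac a s = frac b t.
Proof.
move=> e; apply/fracP; exists 1; split; first exact: p1.
by rewrite e subrr mulr0.
Qed.

Let addA : associative add.
Proof.
move=> u v w; have [a [s ->]] := frac_surj u; have [b [t ->]] := frac_surj v.
by have [c [r ->]] := frac_surj w; rewrite !fracD; apply: frac_eq => /=; ring.
Qed.

Let addC : commutative add.
Proof.
move=> u v; have [a [s ->]] := frac_surj u; have [b [t ->]] := frac_surj v.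
by rewrite !fracD; apply: frac_eq => /=; ring.
Qed.

Let add0 : left_id zero add.
Proof.
by move=> u; have [a [s ->]] := frac_surj u; rewrite fracD; apply: frac_eq => /=; ring.
Qed.

Let addN : left_inverse zero opp add.
Proof.
move=> u; have [a [s ->]] := frac_surj u.
by rewrite fracN fracD; apply: frac_eq => /=; ring.
Qed.

HB.instance Definition _ := GRing.isZmodule.Build localization addA addC add0 addN.

Let mulA : associative mul.
Proof.
move=> u v w; have [a [s ->]] := frac_surj u; have [b [t ->]] := frac_surj v.
by have [c [r ->]] := frac_surj w; rewrite !fracM; apply: frac_eq => /=; ring.
Qed.

Let mulC : commutative mul.
Proof.
move=> u v; have [a [s ->]] := frac_surj u; have [b [t ->]] := frac_surj v.
by rewrite !fracM; apply: frac_eq => /=; ring.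
Qed.

Let mul1 : left_id one mul.
Proof.
by move=> u; have [a [s ->]] := frac_surj u; rewrite fracM; apply: frac_eq => /=; ring.
Qed.

Let mulD : left_distributive mul add.
Proof.
move=> u v w; have [a [s ->]] := frac_surj u; have [b [t ->]] := frac_surj v.
by have [c [r ->]] := frac_surj w; rewrite !(fracD, fracM); apply: frac_eq => /=; ring.
Qed.

HB.instance Definition _ :=
  GRing.Zmodule_isComPzRing.Build localization mulA mulC mul1 mulD.

Lemma frac_add a s b t :
  frac a s + frac b t = frac (a * val t + b * val s) (denM s t).
Proof. exact: fracD. Qed.

Lemma frac_mul a s b t : frac a s * frac b t = frac (a * b) (denM s t).
Proof. exact: fracM. Qed.

End Localization.

Definition regular_ring (R : comPzRingType) : Prop :=
  noetherian R /\ forall p : prime_ideal R, regular_local (localization p).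

Section Tensor.
Variables (R A B : comPzRingType) (f : {rmorphism R -> A}) (g : {rmorphism R -> B}).

(* A (x)_R B is built as the commutative ring presented by generators a (x) 1
   and 1 (x) b; [tensor_universal] below identifies it. *)
Inductive tterm : Type :=
  | TL of A
  | TR of B
  | TAdd of tterm & tterm
  | TOpp of tterm
  | TMul of tterm & tterm.

HB.instance Definition _ := gen_eqMixin tterm.
HB.instance Definition _ := gen_choiceMixin tterm.

Inductive tcong : tterm -> tterm -> Prop :=
  | tc_refl t : tcong t t
  | tc_sym t u : tcong t u -> tcong u t
  | tc_trans t u v : tcong t u -> tcong u v -> tcong t v
  | tc_add t t' u u' : tcong t t' -> tcong u u' -> tcong (TAdd t u) (TAdd t' u')
  | tc_opp t t' : tcong t t' -> tcong (TOpp t) (TOpp t')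
  | tc_mul t t' u u' : tcong t t' -> tcong u u' -> tcong (TMul t u) (TMul t' u')
  | tc_addA t u v : tcong (TAdd t (TAdd u v)) (TAdd (TAdd t u) v)
  | tc_addC t u : tcong (TAdd t u) (TAdd u t)
  | tc_add0 t : tcong (TAdd (TL 0) t) t
  | tc_addN t : tcong (TAdd (TOpp t) t) (TL 0)
  | tc_mulA t u v : tcong (TMul t (TMul u v)) (TMul (TMul t u) v)
  | tc_mulC t u : tcong (TMul t u) (TMul u t)
  | tc_mul1 t : tcong (TMul (TL 1) t) t
  | tc_mulD t u v : tcong (TMul (TAdd t u) v) (TAdd (TMul t v) (TMul u v))
  | tc_LD a a' : tcong (TL (a + a')) (TAdd (TL a) (TL a'))
  | tc_LM a a' : tcong (TL (a * a')) (TMul (TL a) (TL a'))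
  | tc_RD b b' : tcong (TR (b + b')) (TAdd (TR b) (TR b'))
  | tc_RM b b' : tcong (TR (b * b')) (TMul (TR b) (TR b'))
  | tc_R1 : tcong (TR 1) (TL 1)
  | tc_bal r : tcong (TL (f r)) (TR (g r)).

Definition tcongb t u : bool := `[< tcong t u >].

Lemma tcongb_equiv : equiv_class_of tcongb.
Proof.
split=> [t|t u|u t v]; first exact/asboolP/tc_refl.
  by apply/asboolP/asboolP; apply: tc_sym.
by move=> /asboolP tu /asboolP uv; apply/asboolP; apply: tc_trans tu uv.
Qed.

Canonical tcong_equiv := EquivRelPack tcongb_equiv.
Canonical tcong_encModRel := defaultEncModRel tcongb.

Definition tensor := {eq_quot tcongb}.
HB.instance Definition _ := Choice.on tensor.

Let tpi (t : tterm) : tensor := \pi_tensor t.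

Let tpiP t u : tpi t = tpi u <-> tcong t u.
Proof.
split=> [/eqP|H]; first by rewrite /tpi piE => /asboolP.
by apply/eqP; rewrite /tpi piE; apply/asboolP.
Qed.

Let tpi_surj (x : tensor) : exists t, x = tpi t.
Proof. by exists (repr x); rewrite /tpi reprK. Qed.

Let repr_tpi t : tcong (repr (tpi t)) t.
Proof. by apply/tpiP; rewrite /tpi reprK. Qed.

Let add (x y : tensor) := tpi (TAdd (repr x) (repr y)).
Let opp (x : tensor) := tpi (TOpp (repr x)).
Let mul (x y : tensor) := tpi (TMul (repr x) (repr y)).

Let tpiD t u : add (tpi t) (tpi u) = tpi (TAdd t u).
Proof. by apply/tpiP/tc_add. Qed.

Let tpiN t : opp (tpi t) = tpi (TOpp t).
Proof. by apply/tpiP/tc_opp. Qed.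

Let tpiM t u : mul (tpi t) (tpi u) = tpi (TMul t u).
Proof. by apply/tpiP/tc_mul. Qed.

Let addA : associative add.
Proof.
move=> x y z; have [t ->] := tpi_surj x; have [u ->] := tpi_surj y.
by have [v ->] := tpi_surj z; rewrite !tpiD; apply/tpiP/tc_addA.
Qed.

Let addC : commutative add.
Proof.
move=> x y; have [t ->] := tpi_surj x; have [u ->] := tpi_surj y.
by rewrite !tpiD; apply/tpiP/tc_addC.
Qed.

Let add0 : left_id (tpi (TL 0)) add.
Proof. by move=> x; have [t ->] := tpi_surj x; rewrite tpiD; apply/tpiP/tc_add0. Qed.

Let addN : left_inverse (tpi (TL 0)) opp add.
Proof. by move=> x; have [t ->] := tpi_surj x; rewrite tpiN tpiD; apply/tpiP/tc_addN. Qed.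

HB.instance Definition _ := GRing.isZmodule.Build tensor addA addC add0 addN.

Let mulA : associative mul.
Proof.
move=> x y z; have [t ->] := tpi_surj x; have [u ->] := tpi_surj y.
by have [v ->] := tpi_surj z; rewrite !tpiM; apply/tpiP/tc_mulA.
Qed.

Let mulC : commutative mul.
Proof.
move=> x y; have [t ->] := tpi_surj x; have [u ->] := tpi_surj y.
by rewrite !tpiM; apply/tpiP/tc_mulC.
Qed.

Let mul1 : left_id (tpi (TL 1)) mul.
Proof. by move=> x; have [t ->] := tpi_surj x; rewrite tpiM; apply/tpiP/tc_mul1. Qed.

Let mulD : left_distributive mul add.
Proof.
move=> x y z; have [t ->] := tpi_surj x; have [u ->] := tpi_surj y.
by have [v ->] := tpi_surj z; rewrite tpiD !tpiM tpiD; apply/tpiP/tc_mulD.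
Qed.

HB.instance Definition _ :=
  GRing.Zmodule_isComPzRing.Build tensor mulA mulC mul1 mulD.

Definition tensl (a : A) : tensor := tpi (TL a).
Definition tensr (b : B) : tensor := tpi (TR b).

Let additive_zmod (C : comPzRingType) (h : C -> tensor) :
  (forall a b, h (a + b) = h a + h b) -> zmod_morphism h.
Proof. by move=> hD x y; apply/eqP; rewrite -subr_eq opprK -hD subrK. Qed.

Let tensl_zmod : zmod_morphism tensl.
Proof.
apply: additive_zmod => a b; rewrite [RHS]tpiD; exact/tpiP/tc_LD.
Qed.

Let tensl_monoid : monoid_morphism tensl.
Proof. by split=> // a b; rewrite [RHS]tpiM; apply/tpiP/tc_LM. Qed.

Let tensr_zmod : zmod_morphism tensr.
Proof.
apply: additive_zmod => a b; rewrite [RHS]tpiD; exact/tpiP/tc_RD.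
Qed.

Let tensr_monoid : monoid_morphism tensr.
Proof.
split; first exact/tpiP/tc_R1.
by move=> a b; rewrite [RHS]tpiM; apply/tpiP/tc_RM.
Qed.

HB.instance Definition _ := GRing.isZmodMorphism.Build A tensor tensl tensl_zmod.
HB.instance Definition _ := GRing.isMonoidMorphism.Build A tensor tensl tensl_monoid.
HB.instance Definition _ := GRing.isZmodMorphism.Build B tensor tensr tensr_zmod.
HB.instance Definition _ := GRing.isMonoidMorphism.Build B tensor tensr tensr_monoid.

Lemma tens_bal r : tensl (f r) = tensr (g r).
Proof. exact/tpiP/tc_bal. Qed.

Lemma tensor_ind (P : tensor -> Prop) :
  (forall a, P (tensl a)) -> (forall b, P (tensr b)) ->
  (forall x y, P x -> P y -> P (x + y)) -> (forall x, P x -> P (- x)) ->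
  (forall x y, P x -> P y -> P (x * y)) -> forall x, P x.
Proof.
move=> PL PR PD PN PM x; have [t ->] := tpi_surj x.
elim: t => [a|b|t IHt u IHu|t IHt|t IHt u IHu]; first exact: PL.
- exact: PR.
- by rewrite -tpiD; apply: PD.
- by rewrite -tpiN; apply: PN.
- by rewrite -tpiM; apply: PM.
Qed.

Section Universal.
Variables (C : comPzRingType) (h : {rmorphism A -> C}) (k : {rmorphism B -> C}).
Hypothesis hk : forall r, h (f r) = k (g r).

Fixpoint teval (t : tterm) : C :=
  match t with
  | TL a => h a
  | TR b => k b
  | TAdd t u => teval t + teval u
  | TOpp t => - teval t
  | TMul t u => teval t * teval u
  end.

Let teval_cong t u : tcong t u -> teval t = teval u.
Proof.
by elim=> //= *; first [congruence | ring].
Qed.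

Lemma tensor_universal :
  exists2 l : {rmorphism tensor -> C},
    (forall a, l (tensl a) = h a) /\ (forall b, l (tensr b) = k b) &
    forall l' : {rmorphism tensor -> C},
      (forall a, l' (tensl a) = h a) -> (forall b, l' (tensr b) = k b) -> l' =1 l.
Proof.
pose e (x : tensor) := teval (repr x).
have eE t : e (tpi t) = teval t by apply/teval_cong/repr_tpi.
have eD x y : e (x + y) = e x + e y.
  by have [t ->] := tpi_surj x; have [u ->] := tpi_surj y; rewrite [_ + _]tpiD !eE.
have e0 : e 0 = 0 by rewrite eE /= rmorph0.
have eB : zmod_morphism e.
  by move=> x y; apply/eqP; rewrite -subr_eq opprK -eD subrK.
have eM : monoid_morphism e.
  split=> [|x y]; first by rewrite eE /= rmorph1.
  by have [t ->] := tpi_surj x; have [u ->] := tpi_surj y; rewrite [_ * _]tpiM !eE.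
pose ea := GRing.isZmodMorphism.Build tensor C e eB.
pose em := GRing.isMonoidMorphism.Build tensor C e eM.
pose l : {rmorphism tensor -> C} := HB.pack e ea em.
exists l; first by split=> x; rewrite /= eE.
move=> l' ha kb; apply: tensor_ind => [a|b|x y Hx Hy|x Hx|x y Hx Hy].
- by rewrite ha /= eE.
- by rewrite kb /= eE.
- by rewrite !rmorphD Hx Hy.
- by rewrite !rmorphN Hx.
- by rewrite !rmorphM Hx Hy.
Qed.

End Universal.
End Tensor.

(* A commutative k-algebra is given by its structure morphism k -> A. *)
Definition alg_iso (k A B : comPzRingType)
    (f : {rmorphism k -> A}) (g : {rmorphism k -> B}) : Prop :=
  exists phi : {rmorphism A -> B}, bijective phi /\ forall r, phi (f r) = g r.

(* A closed point of Spec R is a maximal ideal; its residue field is R / m. *)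
Record closed_point (R : comPzRingType) := ClosedPoint {
  point_ideal : R -> Prop;
  point_maximal : is_maximal point_ideal
}.

Section ResidueField.
Variables (R : comPzRingType) (eta : closed_point R).
Let m := point_ideal eta.

Definition residue_field := qring m.
HB.instance Definition _ := GRing.ComPzRing.on residue_field.

Let mP x : gen_ideal m x <-> m x.
Proof.
have [mI _ _] := point_maximal eta.
by split; [apply: gen_ideal_min | apply: gen_ideal_sub].
Qed.

Let residue_neq0 : (1 : residue_field) != 0.
Proof. by apply: qring_neq0; rewrite mP; have [] := point_maximal eta. Qed.

HB.instance Definition _ := GRing.PzSemiRing_isNonZero.Build residue_field residue_neq0.

Let residue_inv (u : residue_field) : exists v, (u = 0 -> v = 0) /\ (u <> 0 -> v * u = 1).
Proof.
have [u0|/eqP un0] := eqVneq u 0; first by exists 0.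
have [x ux] := qpi_surj u.
have [[m0 mD mM] m1 mmax] := point_maximal eta.
pose J y := exists a b, m b /\ y = a * x + b.
have JI : is_ideal J.
  split; first by exists 0, 0; split=> //; ring.
    move=> y z [a [b [mb ->]]] [a' [b' [mb' ->]]].
    by exists (a + a'), (b + b'); split; [apply: mD | ring].
  by move=> c y [a [b [mb ->]]]; exists (c * a), (c * b); split; [apply: mM | ring].
have [|J1] := pselect (J 1).
  move=> [a [b [mb e]]]; exists (qpi m a); split=> // _.
  rewrite ux -rmorphM -[RHS](rmorph1 (qpi m)); apply/qpiP/mP.
  have -> : a * x - 1 = (-1) * b by rewrite [X in a * x - X]e; ring.
  exact: mM.
case: un0; rewrite ux -(rmorph0 (qpi m)); apply/qpiP/mP; rewrite subr0.
apply: (mmax J) => // [y my|]; first by exists 0, y; split=> //; ring.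
by exists 1, 0; split=> //; ring.
Qed.

Let inv (u : residue_field) : residue_field := sval (cid (residue_inv u)).

Let mulVf u : u != 0 -> inv u * u = 1.
Proof. by move=> /eqP; have [_] := svalP (cid (residue_inv u)); apply. Qed.

Let inv0 : inv 0 = 0.
Proof. by have [+ _] := svalP (cid (residue_inv 0)); apply. Qed.

HB.instance Definition _ := GRing.ComNzRing_isField.Build residue_field mulVf inv0.

Definition residue : R -> residue_field := qpi m.
HB.instance Definition _ := GRing.RMorphism.on residue.

End ResidueField.

(* V(F) is a hypersurface when F is nonconstant, i.e. 1 < msize F = deg F + 1. *)
Definition iso_regular_hypersurface (n : nat) (k : fieldType) (A : comPzRingType)
    (f : {rmorphism k -> A}) : Prop :=
  exists F : {mpoly k[n]},
    [/\ (1 < msize F)%N,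
        regular_ring (qring (eq F)) &
        alg_iso f (qpi (eq F) \o @mpolyC n k)].

Definition o1 : 'I_4 := @Ordinal 4 0 isT.
Definition o2 : 'I_4 := @Ordinal 4 1 isT.
Definition o3 : 'I_4 := @Ordinal 4 2 isT.
Definition o4 : 'I_4 := @Ordinal 4 3 isT.

Section Laurent.
Variable K : fieldType.

Let c (i : 'I_4) : {mpoly K[4 + 4]} := 'X_(lshift 4 i).
Let c' (i : 'I_4) : {mpoly K[4 + 4]} := 'X_(rshift 4 i).

Definition laurent_rel (P : {mpoly K[4 + 4]}) : Prop := exists i, P = c i * c' i - 1.

(* K[c_1^{+-1}, ..., c_4^{+-1}] as K[c_1, ..., c_4, c'_1, ..., c'_4] modulo
   c_i c'_i = 1; the first four variables are the c_i, the last four the c'_i. *)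
Definition laurent := qring laurent_rel.
HB.instance Definition _ := GRing.ComPzRing.on laurent.

Let laurent_neq0 : (1 : laurent) != 0.
Proof.
apply: qring_neq0 => I1.
pose ev : {rmorphism {mpoly K[4 + 4]} -> K} := mmap (@idfun K) (fun=> 1).
suff H : forall P, gen_ideal laurent_rel P -> ev P = 0.
  by move: (H 1 I1); rewrite rmorph1 => /eqP; rewrite oner_eq0.
apply: (gen_ideal_min (I := fun P => ev P = 0)) => [|P [i ->]].
  split=> [|x y|a x]; first exact: rmorph0.
    by rewrite rmorphD => -> ->; rewrite addr0.
  by rewrite rmorphM => ->; rewrite mulr0.
by rewrite rmorphB rmorphM rmorph1 /= !mmapX !mmap1U mul1r subrr.
Qed.

HB.instance Definition _ := GRing.PzSemiRing_isNonZero.Build laurent laurent_neq0.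

Definition laurentC : K -> laurent := qpi laurent_rel \o @mpolyC (4 + 4) K.
HB.instance Definition _ := GRing.RMorphism.on laurentC.

Definition laurentX (i : 'I_4) : laurent := qpi laurent_rel (c i).

End Laurent.

Section ClusterF4.
Variables (R : comNzRingType) (c : 'I_4 -> R).

(* The first four variables are x_1, ..., x_4 and the last four y_1, ..., y_4;
   o1, ..., o4 are the indices 1, ..., 4. *)
Let x (i : 'I_4) : {mpoly R[4 + 4]} := 'X_(lshift 4 i).
Let y (i : 'I_4) : {mpoly R[4 + 4]} := 'X_(rshift 4 i).

Definition F4_rel (P : {mpoly R[4 + 4]}) : Prop :=
  P \in [:: x o1 * y o1 - (c o1)%:MP - x o2;
            x o2 * y o2 - (c o2)%:MP * x o1 - x o3 ^+ 2;
            x o3 * y o3 - (c o3)%:MP * x o2 - x o4;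
            x o4 * y o4 - (c o4)%:MP * x o3 - 1].

Definition F4_algebra := qring F4_rel.
HB.instance Definition _ := GRing.ComPzRing.on F4_algebra.

Definition F4_str : R -> F4_algebra := qpi F4_rel \o @mpolyC (4 + 4) R.
HB.instance Definition _ := GRing.RMorphism.on F4_str.

End ClusterF4.

Definition A_prin (K : fieldType) := F4_algebra (@laurentX K).
Definition A_prin_str (K : fieldType) : {rmorphism laurent K -> A_prin K} :=
  F4_str (@laurentX K).

Definition A_triv (K : fieldType) := F4_algebra (fun=> 1 : K).
Definition A_triv_str (K : fieldType) : {rmorphism K -> A_triv K} :=
  F4_str (fun=> 1 : K).

Section Families.
Variable K : fieldType.

(* A(F_4) (x)_K K_c, viewed over K_c through its right factor. *)
Definition trivial_family := tensor (A_triv_str K) (@laurentC K).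
Definition trivial_family_str : {rmorphism laurent K -> trivial_family} :=
  @tensr _ _ _ (A_triv_str K) (@laurentC K).

Variable eta : closed_point (laurent K).

(* A_prin (x)_{K_c} kappa(eta), viewed over kappa(eta). *)
Definition fiber := tensor (A_prin_str K) (residue eta).
Definition fiber_str : {rmorphism residue_field eta -> fiber} :=
  @tensr _ _ _ (A_prin_str K) (residue eta).

(* A(F_4) (x)_K kappa(eta), viewed over kappa(eta). *)
Definition A_triv_at := tensor (A_triv_str K) (residue eta \o @laurentC K).
Definition A_triv_at_str : {rmorphism residue_field eta -> A_triv_at} :=
  @tensr _ _ _ (A_triv_str K) (residue eta \o @laurentC K).

End Families.

(* Main.v *)
Require Import Defs.
From HB Require Import structures.
From mathcomp Require Import all_boot all_order all_algebra.
From mathcomp Require Import boolp mpoly ring.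

(** Why the theorem holds.

    Triviality of the family is a change of coordinates.  Substituting
    x_i = a_i X_i and y_i = b_i Y_i with a_i, b_i units turns the relations with
    coefficients c into those with coefficients 1 as soon as a_3 = c_4^-1,
    a_2 = c_1, a_1 = (c_2 c_4^2)^-1, a_4 = c_1 c_3 and the b_i are chosen to
    match ([F4_trivial_coefficients]).  This works over any base in which the
    c_i are units, and the presentation is compatible with base change
    ([F4_base_change]); together they give the trivial family and identify
    every fiber with the algebra with trivial coefficients over the residue
    field.

    With trivial coefficients, the relations 4, 3, 2 express x_3, x_2, x_1, in
    this order, as polynomials in x_4, y_4, y_3, y_2, and relation 1 remains:
    it is the equation of a hypersurface in affine 5-space
    ([hypersurface_presented]).

    Regularity is seen on three charts.  If x_1 is inverted, y_1 can be
    eliminated and the algebra becomes a localization of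
    K[x_4, y_4, y_3, y_2]; if x_2 and x_4, or x_2 and x_3, are inverted, it is
    a localization of a polynomial ring in x_1, y_1, x_3, y_3, or in
    x_1, y_1, x_4, y_4.  Since x_1 y_1 = 1 + x_2 and x_4 y_4 = 1 + x_3, no prime
    contains both x_1 and x_2, nor both x_4 and x_3, so the charts cover
    ([charts_cover]).  Every local ring is therefore a local ring of affine
    4-space.

    What is left is that the local rings of K[z_1, ..., z_n] are regular, over
    an arbitrary field.  For a prime P, induction on n
    ([polynomial_prime_step], [ipoly_prime]) produces a number h, h local
    generators of P, a chain of primes of length h below P, and n - h
    elements that are algebraically independent modulo P: passing from p in R
    to P in R[x] above p, either P consists of the polynomials with
    coefficients in p, and x is a new independent element, or one more
    generator is needed and the chain grows by one.  The chain is maximal: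
    elements picked in the successive differences of a chain of length r
    below P extend the independent family ([chain_length_bound]), so that
    K[t_1, ..., t_(n - h + r)] embeds into K[z_1, ..., z_n], which forces
    r <= h by counting monomials ([ipoly_embedding_dim]).  Hence the local ring
    at P has dimension h and a maximal ideal with h generators.
    Noetherianity comes from Hilbert's basis theorem ([hilbert_basis]). *)

Set Implicit Arguments.
Unset Strict Implicit.
Unset Printing Implicit Defensive.

Import GRing.Theory.
Local Open Scope ring_scope.

(** * Ring morphisms out of polynomial rings and quotients *)

Section Universal.
Variable C : comPzRingType.

(** Settles the evaluation lemmas below when the target, possibly a quotient by
    the unit ideal, is the zero ring. *)
Lemma zero_ring_rmorphism (R : pzRingType) :
  (1 : C) = 0 -> exists e : {rmorphism R -> C}, forall x, e x = 0.
Proof.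
move=> C10; have C0 (x y : C) : x = y by rewrite -[x]mul1r -[y]mul1r C10 !mul0r.
pose e (x : R) : C := 0.
have eB : zmod_morphism e by move=> x y; apply: C0.
have eM : monoid_morphism e by split=> [|x y]; apply: C0.
pose ea := GRing.isZmodMorphism.Build R C e eB.
pose em := GRing.isMonoidMorphism.Build R C e eM.
by exists (HB.pack e ea em : {rmorphism R -> C}).
Qed.

Lemma poly_eval_exists (R : comNzRingType) (f : {rmorphism R -> C}) (x : C) :
  exists2 e : {rmorphism {poly R} -> C}, forall a, e a%:P = f a & e 'X = x.
Proof.
have [C10|/eqP C1] := pselect ((1 : C) = 0).
  have C0 (a b : C) : a = b by rewrite -[a]mul1r -[b]mul1r C10 !mul0r.
  by have [e _] := zero_ring_rmorphism {poly R} C10; exists e => [a|]; apply: C0.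
pose nz := GRing.PzSemiRing_isNonZero.Build C C1.
pose C' : comNzRingType := HB.pack C nz.
pose f' : {rmorphism R -> C'} := f.
have fx : commr_rmorph f' (x : C') by move=> a; exact: (@mulrC C).
pose e : {rmorphism {poly R} -> C'} := horner_morph fx.
by exists (e : {rmorphism {poly R} -> C}) => [a|]; rewrite /= ?horner_morphC ?horner_morphX.
Qed.

Lemma mpoly_eval_exists n (R : comNzRingType) (f : {rmorphism R -> C}) (v : 'I_n -> C) :
  exists2 e : {rmorphism {mpoly R[n]} -> C}, forall a, e a%:MP = f a & forall i, e 'X_i = v i.
Proof.
have [C10|/eqP C1] := pselect ((1 : C) = 0).
  have C0 (a b : C) : a = b by rewrite -[a]mul1r -[b]mul1r C10 !mul0r.
  by have [e _] := zero_ring_rmorphism {mpoly R[n]} C10; exists e => [a|i]; apply: C0.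
pose nz := GRing.PzSemiRing_isNonZero.Build C C1.
pose C' : comNzRingType := HB.pack C nz.
pose f' : {rmorphism R -> C'} := f.
pose e : {rmorphism {mpoly R[n]} -> C'} := mmap f' (v : 'I_n -> C').
by exists (e : {rmorphism {mpoly R[n]} -> C}) => [a|i]; rewrite /= ?mmapC ?mmapX ?mmap1U.
Qed.

Lemma poly_rmorph_eq (R : nzRingType) (e e' : {rmorphism {poly R} -> C}) :
  (forall a, e a%:P = e' a%:P) -> e 'X = e' 'X -> e =1 e'.
Proof.
move=> eC eX; elim/poly_ind=> [|p a IH]; first by rewrite !rmorph0.
by rewrite !rmorphD !rmorphM IH eX eC.
Qed.

Lemma mpoly_subring_ind n (R : nzRingType) (P : {mpoly R[n]} -> Prop) :
  (forall a, P a%:MP) -> (forall i, P 'X_i) ->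
  (forall p q, P p -> P q -> P (p + q)) -> (forall p q, P p -> P q -> P (p * q)) ->
  forall p, P p.
Proof.
move=> PC PX PD PM p; have P0 : P 0 by rewrite -mpolyC0.
have P1 : P 1 by rewrite -mpolyC1.
rewrite [p]mpolyE; apply: (big_ind P P0 PD) => m _.
rewrite -mul_mpolyC; apply: (PM) => //; rewrite mpolyXE_id; apply: (big_ind P P1 PM) => i _.
by elim: (m i) => [|k IH]; rewrite ?expr0 ?exprS //; apply: PM.
Qed.

Lemma qring_lift (R : comPzRingType) (S : R -> Prop) (f : {rmorphism R -> C}) :
  (forall x, S x -> f x = 0) ->
  exists e : {rmorphism qring S -> C}, forall x, e (qpi S x) = f x.
Proof.
move=> fS; pose e (u : qring S) : C := f (repr u).
have eE x : e (qpi S x) = f x.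
  have /qpiP H : qpi S (repr (qpi S x)) = qpi S x by rewrite /qpi generic_quotient.reprK.
  apply/eqP; rewrite -subr_eq0 -rmorphB; apply/eqP.
  apply: (gen_ideal_min (I := fun y => f y = 0)) H => //.
  split=> [|a b fa fb|a b fb]; first exact: rmorph0.
    by rewrite rmorphD fa fb addr0.
  by rewrite rmorphM fb mulr0.
have eB : zmod_morphism e.
  move=> u v; have [x ->] := qpi_surj u; have [y ->] := qpi_surj v.
  by rewrite -rmorphB !eE rmorphB.
have eM : monoid_morphism e.
  split=> [|u v]; first by rewrite -(rmorph1 (qpi S)) eE rmorph1.
  have [x ->] := qpi_surj u; have [y ->] := qpi_surj v.
  by rewrite -rmorphM !eE rmorphM.
pose ea := GRing.isZmodMorphism.Build _ C e eB.
pose em := GRing.isMonoidMorphism.Build _ C e eM.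
by exists (HB.pack e ea em : {rmorphism qring S -> C}).
Qed.

End Universal.

Section AlgIso.
Variable k : comPzRingType.

Lemma alg_iso_of_inverse (A B : comPzRingType) (f : {rmorphism k -> A})
    (g : {rmorphism k -> B}) (u : {rmorphism A -> B}) (v : {rmorphism B -> A}) :
  (forall r, u (f r) = g r) -> cancel u v -> cancel v u -> alg_iso f g.
Proof. by move=> uf uv vu; exists u; split=> //; exists v. Qed.

Lemma alg_iso_sym (A B : comPzRingType) (f : {rmorphism k -> A}) (g : {rmorphism k -> B}) :
  alg_iso f g -> alg_iso g f.
Proof.
move=> [u [[v uv vu] uf]].
have vB : zmod_morphism v.
  by move=> x y; apply: (can_inj uv); rewrite vu rmorphB !vu.
have vM : monoid_morphism v.
  by split=> [|x y]; apply: (can_inj uv); rewrite vu ?rmorph1 ?rmorphM ?vu.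
pose va := GRing.isZmodMorphism.Build B A v vB.
pose vm := GRing.isMonoidMorphism.Build B A v vM.
exists (HB.pack v va vm : {rmorphism B -> A}); split; first by exists u.
by move=> r; rewrite /= -uf uv.
Qed.

Lemma alg_iso_trans (A B C : comPzRingType) (f : {rmorphism k -> A})
    (g : {rmorphism k -> B}) (h : {rmorphism k -> C}) :
  alg_iso f g -> alg_iso g h -> alg_iso f h.
Proof.
move=> [u [ub uf]] [v [vb vg]]; exists (v \o u); split; first exact: bij_comp.
by move=> r /=; rewrite uf vg.
Qed.

End AlgIso.

(** * Iterated polynomial rings and the dimension bound for embeddings *)

Section IteratedPolynomials.
Variable K : fieldType.

(** Adjoining one variable at a time lets results on polynomial rings be proved
    by induction on n from the univariate case. *)
Fixpoint ipoly (n : nat) : idomainType :=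
  if n is m.+1 then {poly ipoly m} else K.

Fixpoint ipolyC (n : nat) : {rmorphism K -> ipoly n} :=
  match n return {rmorphism K -> ipoly n} with
  | 0 => idfun
  | m.+1 => @polyC (ipoly m) \o ipolyC m
  end.

(** Meant for i < n; the value is 0 otherwise. *)
Fixpoint ipolyX (n i : nat) : ipoly n :=
  match n return ipoly n with
  | 0 => 0
  | m.+1 => if i == m then 'X else (ipolyX m i)%:P
  end.

Lemma ipoly_eval_exists n (C : comPzRingType) (f : {rmorphism K -> C}) (v : nat -> C) :
  exists2 e : {rmorphism ipoly n -> C},
    forall a, e (ipolyC n a) = f a & forall i, (i < n)%N -> e (ipolyX n i) = v i.
Proof.
elim: n => [|n [e eC eX]]; first by exists f.
have [e' eC' eX'] := poly_eval_exists e (v n); exists e' => [a|i].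
  by rewrite /= eC' eC.
rewrite ltnS leq_eqVlt /=; case: eqVneq => [-> _|_ /= i_n]; first exact: eX'.
by rewrite eC' eX.
Qed.

Lemma ipoly_rmorph_eq n (C : comPzRingType) (e e' : {rmorphism ipoly n -> C}) :
  (forall a, e (ipolyC n a) = e' (ipolyC n a)) ->
  (forall i, (i < n)%N -> e (ipolyX n i) = e' (ipolyX n i)) -> e =1 e'.
Proof.
elim: n e e' => [|n IH] e e' eC eX; first exact: eC.
apply: (@poly_rmorph_eq C (ipoly n)); last by have := eX n (ltnSn n); rewrite /= eqxx.
apply: (IH (e \o @polyC (ipoly n)) (e' \o @polyC (ipoly n))) => [a|i i_n]; first exact: eC.
by have := eX i (ltnW i_n); rewrite /= (ltn_eqF i_n).
Qed.

(** The degree is bounded in each variable separately, so that the number of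
    coefficients is a plain power of D + 1. *)
Fixpoint box (n D : nat) : ipoly n -> Prop :=
  match n return ipoly n -> Prop with
  | 0 => fun=> True
  | m.+1 => fun f : {poly ipoly m} => (size f <= D.+1)%N /\ forall i, box D f`_i
  end.

Lemma box0 n D : box D (0 : ipoly n).
Proof. by elim: n => [//|n IH] /=; rewrite size_poly0; split=> // i; rewrite coef0. Qed.

Lemma box_add n D (f g : ipoly n) : box D f -> box D g -> box D (f + g).
Proof.
elim: n f g => [//|n IH] /= f g [sf bf] [sg bg]; split=> [|i].
  by apply: leq_trans (size_polyD _ _) _; rewrite geq_max sf.
by rewrite coefD; apply: IH.
Qed.

Lemma box_mul n D E (f g : ipoly n) : box D f -> box E g -> box (D + E) (f * g).
Proof.
elim: n f g => [//|n IH] /= f g [sf bf] [sg bg]; split=> [|i].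
  apply: leq_trans (size_polyMleq _ _) _.
  by rewrite -subn1 leq_subLR add1n -addnS -addSn leq_add.
rewrite coefM; apply: (big_ind (box (D + E))) => [|x y|j _]; first exact: box0.
  exact: box_add.
exact: IH.
Qed.

Lemma box_mono n D E (f : ipoly n) : (D <= E)%N -> box D f -> box E f.
Proof.
move=> DE; elim: n f => [//|n IH] /= f [sf bf]; split=> [|i]; last exact: IH.
exact: leq_trans sf _.
Qed.

Lemma box_one n D : box D (1 : ipoly n).
Proof.
elim: n => [//|n IH] /=; rewrite size_poly1; split=> // i; rewrite coef1.
by case: (i == 0)%N; [exact: IH | exact: box0].
Qed.

Lemma box_exp n D (f : ipoly n) k : box D f -> box (D * k) (f ^+ k).
Proof.
move=> bf; elim: k => [|k IH]; first exact: box_one.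
by rewrite exprS mulnS; apply: box_mul.
Qed.

Lemma box_exists n (f : ipoly n) : exists D, box D f.
Proof.
elim: n f => [|n IH] /= f; first by exists 0%N.
have [D bD] : exists D, forall i, (i < size f)%N -> box D f`_i.
  elim: (size f) => [|k [D bD]]; first by exists 0%N.
  have [E bE] := IH f`_k; exists (D + E)%N => i; rewrite ltnS leq_eqVlt.
  case/predU1P => [->|/bD bDi]; first exact: box_mono (leq_addl _ _) bE.
  exact: box_mono (leq_addr _ _) bDi.
exists (D + size f)%N; split=> [|i]; first exact: leqW (leq_addl _ _).
have [i_f|f_i] := ltnP i (size f); first by apply: box_mono (bD i i_f); apply: leq_addr.
by rewrite nth_default //; apply: box0.
Qed.

(** More unknowns than equations: a polynomial in a box has (D + 1)^n
    coefficients, so the T-indexed vectors f j satisfy a common linear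
    relation over K once there are more than #|T| * (D + 1)^n of them.  The
    index T makes the induction on n work: the coefficients with respect to
    the last variable become further coordinates. *)
Lemma box_dependence n (T J : finType) D (f : J -> T -> ipoly n) :
  (forall j t, box D (f j t)) -> (#|T| * D.+1 ^ n < #|J|)%N ->
  exists c : J -> K, (exists j, c j != 0) /\
    forall t, \sum_j ipolyC n (c j) * f j t = 0.
Proof.
elim: n T f => [|n IH] T f bf ltTJ.
  pose A : 'M[K]_(#|J|, #|T|) := \matrix_(i, t) f (enum_val i) (enum_val t).
  have /rowV0Pn[v vA v0] : kermx A != 0.
    rewrite -mxrank_eq0 mxrank_ker subn_eq0 -ltnNge.
    by rewrite (leq_ltn_trans (rank_leq_col A)) // -[X in (X < _)%N]muln1.
  exists (fun j => v 0 (enum_rank j)); split.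
    have [i vi] : exists i, v 0 i != 0.
      apply: contra_neqP v0 => H; apply/rowP => i; rewrite mxE.
      by apply: contra_notP H => /eqP vi; exists i.
    by exists (enum_val i); rewrite enum_valK.
  move=> t; have /sub_kermxP/rowP/(_ (enum_rank t)) := vA; rewrite !mxE => vAt; rewrite -[RHS]vAt.
  rewrite (reindex (@enum_val J predT)) /=; last first.
    by exists enum_rank => i _; rewrite ?enum_valK ?enum_rankK.
  by apply: eq_bigr => i _; rewrite !mxE enum_valK enum_rankK.
pose f' j (p : T * 'I_D.+1) : ipoly n := (f j p.1 : {poly ipoly n})`_p.2.
have [||c [c0 cf]] := IH _ f'.
- by move=> j [t i]; have [_] := bf j t; apply.
- by rewrite card_prod card_ord -mulnA -expnS.
exists c; split=> // t; apply/polyP => i; rewrite coef0 coef_sum.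
have [ltiD|leDi] := ltnP i D.+1.
  rewrite -[RHS](cf (t, Ordinal ltiD)); apply: eq_bigr => j _.
  by rewrite /= coefCM.
rewrite big1 // => j _; rewrite /= coefCM [X in _ * X]nth_default ?mulr0 //.
by apply: leq_trans leDi; have [] := bf j t.
Qed.

(** Exponent vectors with entries at most M, nested as the variables of
    [ipoly] are. *)
Fixpoint mon_index (N M : nat) : finType :=
  if N is m.+1 then ('I_M.+1 * mon_index m M)%type else unit.

Fixpoint mon (N M : nat) : mon_index N M -> ipoly N :=
  match N return mon_index N M -> ipoly N with
  | 0 => fun=> 1
  | m.+1 => fun p => (mon p.2)%:P * 'X^(p.1)
  end.

Lemma card_mon_index N M : #|mon_index N M| = (M.+1 ^ N)%N.
Proof. by elim: N => [|N IH] /=; rewrite ?card_unit // card_prod card_ord IH expnS. Qed.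

Lemma mon_free N M (c : mon_index N M -> K) :
  \sum_j ipolyC N (c j) * mon j = 0 -> forall j, c j = 0.
Proof.
elim: N c => [|N IH] c /=.
  by move=> c0 []; rewrite -c0 (big_pred1 tt) /= ?mulr1 //; case.
move=> c0 [k j]; apply: (IH (fun j => c (k, j))) => {j}.
have := congr1 (fun f : {poly ipoly N} => f`_k) c0.
rewrite coef0 coef_sum => ck; rewrite -[RHS]ck.
transitivity (\sum_i \sum_j ((ipolyC N (c (i, j)))%:P * ((mon j)%:P * 'X^i))`_k); last first.
  by rewrite pair_bigA; apply: eq_bigr => -[i j] _.
rewrite [RHS](bigD1 k) //= [X in _ + X]big1 ?addr0 => [|i ik].
  by apply: eq_bigr => j _; rewrite !coefCM coefXn eqxx mulr1.
by rewrite big1 // => j _; rewrite !coefCM coefXn eq_sym (inj_eq val_inj) (negPf ik) !mulr0.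
Qed.

Lemma box_rmorph_mon N n (e : {rmorphism ipoly N -> ipoly n}) :
  exists D, forall M (j : mon_index N M), box (D * M) (e (mon j)).
Proof.
elim: N e => [|N IH] e.
  by exists 0%N => M j /=; rewrite (rmorph1 e); apply: box_one.
have [D bD] := IH (e \o @polyC (ipoly N)); have [E bE] := box_exists (e 'X).
exists (D + E)%N => M [i j] /=; rewrite rmorphM rmorphXn mulnDl.
apply: box_mul; first exact: bD.
by apply: box_mono (box_exp i bE); rewrite leq_mul2l -ltnS ltn_ord orbT.
Qed.

(** The (M + 1)^N monomials of degree at most M in each of N variables are sent
    by e to independent elements of a box of size (D M + 1)^n, where D does
    not depend on M.  If n < N this is impossible for large M. *)
Theorem ipoly_embedding_dim N n (e : {rmorphism ipoly N -> ipoly n}) :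
  (forall a, e (ipolyC N a) = ipolyC n a) -> (forall Q, e Q = 0 -> Q = 0) -> (N <= n)%N.
Proof.
move=> eC e0; rewrite leqNgt; apply/negP => ltnN.
(* (D M + 1)^n <= (D + 1)^n (M + 1)^n, so M = (D + 1)^n is large enough. *)
have [D bD] := box_rmorph_mon e; pose M := (D.+1 ^ n)%N.
have [||c [[j cj] /(_ tt) cf]] :=
  @box_dependence n unit _ (D * M) (fun (j : mon_index N M) _ => e (mon j)).
- by move=> j _; apply: bD.
- rewrite card_unit mul1n card_mon_index.
  apply: (@leq_trans (M.+1 ^ n.+1)); last by rewrite leq_exp2l // ltnS expn_gt0.
  rewrite expnS; apply: (@leq_ltn_trans (M * M.+1 ^ n)).
    rewrite -expnMn; case: (n) => // k; rewrite leq_exp2r //.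
    by rewrite mulSn mulnS addSn ltnS addnA leq_addl.
  by rewrite ltn_mul2r expn_gt0 ltnSn.
case/eqP: cj; apply: (mon_free (c := c)); apply: e0; rewrite -[RHS]cf rmorph_sum.
by apply: eq_bigr => i _; rewrite rmorphM eC.
Qed.

End IteratedPolynomials.

(** * Primes of polynomial rings: generators, chains and transcendence *)

Section PrimeIdeals.
Variable R : comPzRingType.
Implicit Types P Q : R -> Prop.

Lemma ideal0 P : is_ideal P -> P 0. Proof. by case. Qed.
Lemma idealD P x y : is_ideal P -> P x -> P y -> P (x + y). Proof. by case=> _ + _; apply. Qed.
Lemma idealM P a x : is_ideal P -> P x -> P (a * x). Proof. by case=> _ _; apply. Qed.

Lemma idealMr P a x : is_ideal P -> P x -> P (x * a).
Proof. by rewrite mulrC; apply: idealM. Qed.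

Lemma idealB P x y : is_ideal P -> P x -> P y -> P (x - y).
Proof. by move=> PI Px Py; apply: idealD => //; rewrite -mulN1r; apply: idealM. Qed.

Lemma ideal_sum (I : Type) (r : seq I) (p : pred I) (F : I -> R) P :
  is_ideal P -> (forall i, p i -> P (F i)) -> P (\sum_(i <- r | p i) F i).
Proof. by move=> PI PF; apply: (big_ind P) => // [|x y]; [apply: ideal0 | apply: idealD]. Qed.

Lemma primeM P x y : is_prime P -> ~ P x -> ~ P y -> ~ P (x * y).
Proof. by move=> [_ _ PM] nx ny /PM []. Qed.

Lemma primeX P x k : is_prime P -> ~ P x -> ~ P (x ^+ k).
Proof.
move=> PP nx; elim: k => [|k IH]; first by have [_ P1 _] := PP.
by rewrite exprS; apply: primeM.
Qed.

End PrimeIdeals.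

Section PrimeChains.
Variable R : comPzRingType.

Lemma is_ideal_preim (S : comPzRingType) (f : {rmorphism R -> S}) (Q : S -> Prop) :
  is_ideal Q -> is_ideal (fun x => Q (f x)).
Proof.
move=> QI; split; first by rewrite rmorph0; exact: ideal0 QI.
  by move=> x y; rewrite rmorphD; exact: idealD QI.
by move=> a x; rewrite rmorphM; exact: idealM QI.
Qed.

Lemma is_prime_preim (S : comPzRingType) (f : {rmorphism R -> S}) (Q : S -> Prop) :
  is_prime Q -> is_prime (fun x => Q (f x)).
Proof.
move=> [QI Q1 QM]; split; first exact: is_ideal_preim.
  by rewrite rmorph1.
by move=> x y; rewrite rmorphM; apply: QM.
Qed.

Lemma gen_ideal_mono (S S' : R -> Prop) x :
  (forall y, S y -> S' y) -> gen_ideal S x -> gen_ideal S' x.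
Proof.
move=> SS'; apply: gen_ideal_min => [|y Sy]; first exact: gen_ideal_is_ideal.
exact/gen_ideal_sub/SS'.
Qed.

Lemma gen_ideal_image (S : comPzRingType) (f : {rmorphism R -> S}) (A : R -> Prop)
    (B : S -> Prop) x :
  (forall y, A y -> B (f y)) -> gen_ideal A x -> gen_ideal B (f x).
Proof.
move=> AB [n [a [s [As ->]]]]; exists n, (f \o a), (f \o s); split=> [i|]; first exact: AB.
by rewrite rmorph_sum; apply: eq_bigr => i _; rewrite rmorphM.
Qed.

(** Chains indexed by all natural numbers, constrained only up to d, avoid
    dependent indices when a chain is truncated or prolonged. *)
Definition nat_chain (d : nat) (c : nat -> R -> Prop) : Prop :=
  (forall i, (i <= d)%N -> is_prime (c i)) /\
  (forall i, (i < d)%N -> (forall x, c i x -> c i.+1 x) /\ exists x, c i.+1 x /\ ~ c i x).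

Lemma nat_chain_mono d c i j x : nat_chain d c -> (i <= j <= d)%N -> c i x -> c j x.
Proof.
move=> [_ cS] /andP[ij jd] cix; rewrite -(subnKC ij) in jd *.
elim: (j - i)%N jd => [|k IH]; first by rewrite addn0.
by rewrite addnS => jd; apply: (cS _ jd).1; apply/IH/ltnW.
Qed.

Lemma nat_chain_prime_chain d c : nat_chain d c -> @prime_chain R d (fun i => c i).
Proof.
move=> cc; have [cp cS] := cc; split=> [i|i j ij]; first by apply: cp; rewrite -ltnS.
split=> [x|]; first by apply: (nat_chain_mono cc); rewrite ltnW //= -ltnS.
have id : (i < d)%N by rewrite (leq_trans ij) // -ltnS.
have [x [cx ncx]] := (cS _ id).2; exists x; split=> //.
by apply: (nat_chain_mono cc) cx; rewrite ij -ltnS /=.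
Qed.

Lemma prime_chain_nat_chain d (c : 'I_d.+1 -> R -> Prop) :
  prime_chain c -> nat_chain d (fun i => c (inord i)).
Proof.
move=> [cp cS]; split=> [i _|i id]; first exact: cp.
by apply: cS; rewrite !inordK // ltnS ltnW.
Qed.

(** h elements of P generate P in the localization at P: the denominators u are
    kept explicit. *)
Definition local_gens (P : R -> Prop) (h : nat) : Prop :=
  exists s : h.-tuple R, (forall y, y \in s -> P y) /\
    forall x, P x -> exists2 u, ~ P u & gen_ideal (fun y => y \in s) (u * x).

(** Witnesses that the height of P is at least h. *)
Definition top_chain (P : R -> Prop) (h : nat) : Prop :=
  exists2 c, nat_chain h c & forall x, c h x -> P x.

End PrimeChains.

Section PolynomialPrimes.
Variable R : idomainType.

(** The extension p R[x] of an ideal p. *)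
Definition coef_ideal (p : R -> Prop) (f : {poly R}) : Prop := forall i, p f`_i.

(** Gauss: if f and g have their first coefficients outside p in degrees i and
    j, the coefficient of f g in degree i + j is f_i g_j modulo p. *)
Lemma coef_ideal_prime p : is_prime p -> is_prime (coef_ideal p).
Proof.
move=> pp; have [pI p1 _] := pp; split.
- split=> [i|f g pf pg i|a f pf i]; first by rewrite coef0; apply: ideal0.
    by rewrite coefD; apply: idealD.
  by rewrite coefM; apply: ideal_sum => // j _; apply: idealM.
- by move=> /(_ 0%N); rewrite coef1.
move=> f g pfg.
have least (q : {poly R}) : ~ coef_ideal p q ->
    exists2 i, ~ p q`_i & forall j, (j < i)%N -> p q`_j.
  move=> /existsNP[i0 q0]; have ex : exists i, `[< ~ p q`_i >] by exists i0; apply/asboolP.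
  exists (ex_minn ex) => [|j]; case: ex_minnP => i /asboolP // _ imin ji.
  by apply: contrapT => /asboolP /imin; rewrite leqNgt ji.
apply: contrapT => /not_orP[/least[i fi ilt] /least[j gj jlt]].
apply: (primeM pp fi gj).
have -> : f`_i * g`_j = (f * g)`_(i + j) - \sum_(k < (i + j).+1 | k != i :> nat) f`_k * g`_(i + j - k).
  have ii : (i < (i + j).+1)%N by rewrite ltnS leq_addr.
  by rewrite coefM (bigD1 (Ordinal ii)) //= addKn addrK.
apply: idealB => //; apply: ideal_sum => // k ki.
have [ltki|leik] := ltnP k i; first by apply: idealMr => //; apply: ilt.
apply: idealM => //; apply: jlt.
rewrite ltn_subLR; last by rewrite -ltnS.
rewrite ltn_add2r.
by rewrite ltn_neqAle leik eq_sym ki.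
Qed.

Lemma coef_ideal_chain d c : nat_chain d c -> nat_chain d (fun i => coef_ideal (c i)).
Proof.
move=> [cp cS]; split=> [i id|i id]; first exact/coef_ideal_prime/cp.
have [cc [x [cx ncx]]] := cS _ id.
split=> [f fc j|]; first exact/cc/fc.
exists x%:P; split=> [j|/(_ 0%N)]; last by rewrite coefC.
by rewrite coefC; case: eqP => // _; apply: ideal0; have [] := cp i.+1 id.
Qed.

Variable P : {poly R} -> Prop.
Hypothesis PP : is_prime P.
Let p (a : R) : Prop := P a%:P.

Let pp : is_prime p. Proof. exact: (is_prime_preim (@polyC R) PP). Qed.
Let PI : is_ideal P. Proof. by case: PP. Qed.

Lemma sub_coef_ideal f : coef_ideal p f -> P f.
Proof.
move=> pf; rewrite -[f]coefK poly_def; apply: ideal_sum => // i _.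
by rewrite -mul_polyC; apply: idealMr => //; apply: pf.
Qed.

(** The finitely many coefficients of f admit a common denominator. *)
Lemma coef_local_gens h (s : h.-tuple R) :
  (forall x, p x -> exists2 u, ~ p u & gen_ideal (fun y => y \in s) (u * x)) ->
  forall f, coef_ideal p f ->
  exists2 u, ~ p u & gen_ideal (fun y => y \in [seq a%:P | a <- s]) (u%:P * f).
Proof.
move=> gs f pf; set I := gen_ideal _.
have II : is_ideal I by apply: gen_ideal_is_ideal.
suff [u pu Iu] : exists2 u, ~ p u & forall i, (i < size f)%N -> I (u%:P * (f`_i)%:P).
  exists u => //; rewrite -[f]coefK poly_def mulr_sumr; apply: ideal_sum => // i _.
  by rewrite -mul_polyC mulrA; apply: idealMr => //; apply: Iu.
elim: (size f) => [|k [u pu Iu]]; first by exists 1 => //; case: pp.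
have [v pv Iv] := gs _ (pf k); exists (v * u) => [|i]; first exact: primeM.
rewrite ltnS leq_eqVlt => /predU1P[->|/Iu Iui]; last first.
  by rewrite polyCM -mulrA; apply: idealM.
rewrite mulrC polyCM mulrA; apply: idealMr => //; rewrite mulrC -polyCM.
by apply: gen_ideal_image Iv => y ys; apply: map_f.
Qed.

(** If P is not just the extension of its contraction p, choose f of minimal
    degree in P but not in p[x].  Its leading coefficient is outside p, for
    otherwise the leading term could be dropped.  Pseudo-division of any
    element of P by f leaves a remainder in P of smaller degree, hence in p[x]:
    f together with local generators of p generates P locally. *)
Lemma polynomial_prime_step h :
  local_gens p h -> top_chain p h ->
  [/\ forall f, P f -> coef_ideal p f, local_gens P h & top_chain P h] \/
  local_gens P h.+1 /\ top_chain P h.+1.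
Proof.
move=> [s [sp gs]] [c cc cp].
have [Pp|/existsNP[f0 /not_implyP[Pf0 pf0]]] := pselect (forall f, P f -> coef_ideal p f).
  left; split=> //; last first.
    exists (fun i => coef_ideal (c i)); first exact: coef_ideal_chain.
    by move=> f cf; apply: sub_coef_ideal => i; apply/cp/cf.
  exists [tuple of [seq a%:P | a <- s]]; split=> [y /mapP[a /sp pa ->] //|f Pf].
  by have [u pu Iu] := coef_local_gens gs (Pp f Pf); exists u%:P.
right; split; last first.
  exists (fun i => if (i <= h)%N then coef_ideal (c i) else P); last by rewrite ltnn.
  have [ccp ccS] := coef_ideal_chain cc; split=> [i _|i].
    by case: leqP => [/ccp|].
  rewrite ltnS /= => ih; have [ih'|hi] := ltnP i h; first by rewrite ih; apply: ccS.
  have -> : i = h by apply/eqP; rewrite eqn_leq ih.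
  rewrite ?leqnn ?ltnn; split=> [f cf|]; first by apply: sub_coef_ideal => j; apply/cp/cf.
  by exists f0; split=> // cf0; apply: pf0 => j; apply/cp/cf0.
have exf : exists n, `[< exists f, [/\ P f, ~ coef_ideal p f & size f = n] >].
  by exists (size f0); apply/asboolP; exists f0.
case: (ex_minnP exf) => n /asboolP[f [Pf pf szf]] nmin.
have fmin g : P g -> (size g < size f)%N -> coef_ideal p g.
  move=> Pg; rewrite szf => gn; apply: contrapT => pg.
  suff /nmin : `[< exists f, [/\ P f, ~ coef_ideal p f & size f = size g] >] by rewrite leqNgt gn.
  by apply/asboolP; exists g.
have f_neq0 : f != 0.
  by apply/eqP => fz; apply: pf => i; rewrite fz coef0; apply: ideal0; case: pp.
have plead : ~ p (lead_coef f).
  have [d szd] : exists d, size f = d.+1.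
    by exists (size f).-1; rewrite prednK // lt0n size_poly_eq0.
  rewrite lead_coefE szd /= => pl; apply: pf.
  pose l := (f`_d)%:P * 'X^d.
  have Pl : P l by apply: idealMr.
  have Pfl : P (f - l) by apply: idealB.
  have fl : coef_ideal p (f - l).
    apply: fmin => //; rewrite szd ltnS; apply/leq_sizeP => j.
    rewrite leq_eqVlt coefB coefCM coefXn => /predU1P[<-|dj].
      by rewrite eqxx mulr1 subrr.
    by rewrite gtn_eqF // mulr0 subr0 nth_default // szd.
  have pI : is_ideal p by case: pp.
  move=> i; rewrite -[f](subrK l) coefD; apply: idealD => //.
  by rewrite coefCM; apply: idealMr.
exists [tuple of f :: [seq a%:P | a <- s]]; split=> [y|g Pg].
  by rewrite inE => /predU1P[->//|/mapP[a /sp pa ->]].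
pose k := scalp g f.
have := Pdiv.Idomain.divp_eq g f; rewrite -/k; set q := (g %/ f)%R; set r := (g %% f)%R.
move=> def.
have Pr : P r.
  rewrite -[r](addKr (q * f)) -def addrC; apply: idealB => //; last exact: idealM.
  by rewrite -mul_polyC; apply: idealM.
have pr : coef_ideal p r by apply: fmin => //; rewrite Pdiv.Idomain.ltn_modp.
have [u pu Iu] := coef_local_gens gs pr.
exists (u * lead_coef f ^+ k)%:P; first exact: (primeM pp pu (primeX (k:=k) pp plead)).
have II := gen_ideal_is_ideal (fun y => y \in [tuple of f :: [seq a%:P | a <- s]]).
rewrite polyCM -mulrA mul_polyC [_ * g]mul_polyC def -mul_polyC mulrDr.
apply: idealD => //.
  rewrite mulrA; apply: idealM => //; apply: gen_ideal_sub; exact: mem_head.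
apply: gen_ideal_mono Iu => y ys; by rewrite inE ys orbT.
Qed.

End PolynomialPrimes.

Section IteratedPrimes.
Variable K : fieldType.

(** The morphism e exhibits m elements that are algebraically independent
    modulo P; m + h = n says that h is the codimension of P. *)
Theorem ipoly_prime n (P : ipoly K n -> Prop) : is_prime P ->
  exists m h, [/\ (m + h)%N = n, local_gens P h, top_chain P h &
    exists2 e : {rmorphism ipoly K m -> ipoly K n},
      forall a, e (ipolyC K m a) = ipolyC K n a & forall Q, P (e Q) -> Q = 0].
Proof.
elim: n P => [|n IH] P PP.
  have P0 (x : K) : P x -> x = 0.
    move=> Px; apply: contrapT => /eqP x0; have [PI P1 _] := PP; apply: P1.
    by rewrite -(mulVf x0); apply: idealM.
  exists 0%N, 0%N; split=> //; last by exists idfun.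
    exists [tuple]; split=> // x /P0 ->; exists 1; first by case: PP.
    rewrite mulr0; exact: ideal0 (gen_ideal_is_ideal _).
  by exists (fun=> P).
have [m [h [mh lg tc [e eC eP]]]] := IH _ (is_prime_preim (@polyC (ipoly K n)) PP).
have [[Pp lg' tc']|[lg' tc']] := polynomial_prime_step PP lg tc.
  exists m.+1, h; split=> //; first by rewrite addSn mh.
  exists (map_poly e) => [a|Q /Pp PQ]; first by rewrite /= map_polyC /= eC.
  apply/polyP => i; rewrite coef0; apply: eP; rewrite -coef_map; exact: PQ.
exists m, h.+1; split=> //; first by rewrite addnS mh.
by exists (@polyC (ipoly K n) \o e) => [a|Q /eP//]; rewrite /= eC.
Qed.

(** Induction from the top of the chain.  Choose x in c (r+1) but not in c r and
    adjoin a variable to the source of e, sent to x.  If a polynomial Q X + a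
    lands in c r, then e a lies in c (r+1), because x does, so a = 0; then
    e' Q * x lies in the prime c r, which does not contain x, so e' Q lies in
    c r and Q = 0 by induction on the degree.  Once the chain is exhausted, e is
    an embedding of polynomial rings. *)
Lemma chain_length_bound n r m c (e : {rmorphism ipoly K m -> ipoly K n}) :
  nat_chain r c -> (forall a, e (ipolyC K m a) = ipolyC K n a) ->
  (forall Q, c r (e Q) -> Q = 0) -> (m + r <= n)%N.
Proof.
elim: r m e => [|r IH] m e [cp cS] eC eP.
  rewrite addn0; apply: (ipoly_embedding_dim eC) => Q eQ0; apply: eP.
  by rewrite eQ0; apply: ideal0; have [] := cp 0%N isT.
have [cc [x [crx ncrx]]] := cS r (ltnSn r).
have [e' e'C e'X] := poly_eval_exists e x.
rewrite addnS -addSn; apply: (IH m.+1 e').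
- by split=> i ir; [apply/cp/ltnW | apply/cS/ltnW].
- by move=> a; rewrite /= e'C eC.
have [cr1I _ _] := cp r.+1 (leqnn _); have [_ _ crM] := cp r (leqnSn _).
elim/poly_ind => [//|Q a IHQ]; rewrite rmorphD rmorphM e'X e'C => cQ.
have a0 : a = 0.
  apply: eP; rewrite -[e a](addKr (e' Q * x)) addrC; apply: idealB => //; first exact: cc.
  exact: idealM.
move: cQ; rewrite a0 rmorph0 addr0 => /crM[/IHQ ->|//]; by rewrite mul0r add0r.
Qed.

End IteratedPrimes.

(** * Noetherian rings, localizations and the regularity criterion *)

Lemma noetherian_field (K : fieldType) : noetherian K.
Proof.
move=> I II; have [I1|I1] := pselect (I 1).
  exists [:: 1] => x; split=> _; last by rewrite -[x]mulr1; exact: idealM II I1.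
  rewrite -[x]mulr1; apply: (idealM _ (gen_ideal_is_ideal _)).
  by apply: gen_ideal_sub; rewrite mem_head.
exists [::] => x; split; last by apply: gen_ideal_min.
move=> Ix; have -> : x = 0; last exact: ideal0 (gen_ideal_is_ideal _).
apply: contrapT => /eqP x0; apply: I1; rewrite -(mulVf x0); exact: idealM II Ix.
Qed.

Lemma noetherian_image (R S : comPzRingType) (f : {rmorphism R -> S}) :
  (forall y, exists x, f x = y) -> noetherian R -> noetherian S.
Proof.
move=> fs nR I II; have [s sP] := nR _ (is_ideal_preim f II).
exists (map f s) => y; split=> [|].
  have [x <-] := fs y => /sP; apply: gen_ideal_image => z zs; exact: map_f.
apply: gen_ideal_min => // z /mapP[x xs ->]; apply/(sP x); exact: gen_ideal_sub.
Qed.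

Section HilbertBasis.
Variable R : comNzRingType.

(** Admitting all elements of degree at most n, and not only those of degree n,
    makes this an ideal. *)
Definition lead_ideal (I : {poly R} -> Prop) (n : nat) (c : R) : Prop :=
  exists f, [/\ I f, (size f <= n.+1)%N & f`_n = c].

Lemma lead_ideal_is_ideal I n : is_ideal I -> is_ideal (lead_ideal I n).
Proof.
move=> II; split.
- by exists 0; rewrite size_poly0 coef0; split=> //; apply: ideal0.
- move=> _ _ [f [If sf <-]] [g [Ig sg <-]]; exists (f + g); rewrite coefD; split=> //.
    exact: idealD.
  by rewrite (leq_trans (size_polyD _ _)) // geq_max sf.
move=> a _ [f [If sf <-]]; exists (a%:P * f); rewrite coefCM; split=> //.
  exact: idealM.
by rewrite mul_polyC (leq_trans (size_scale_leq _ _)).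
Qed.

Lemma lead_ideal_mono I m n c : is_ideal I -> (m <= n)%N -> lead_ideal I m c -> lead_ideal I n c.
Proof.
move=> II mn [f [If sf <-]]; exists (f * 'X^(n - m)); split; first exact: idealMr.
  rewrite (leq_trans (size_polyMleq _ _)) // size_polyXn addnS /=.
  by rewrite (leq_trans (leq_add sf (leqnn _))) // addSn subnKC.
by rewrite coefMXn ltnNge leq_subr /= subKn.
Qed.

(** The ideals [lead_ideal I n] increase with n and their union U is finitely
    generated, so they are constant from some N on.  Lifting generators of
    [lead_ideal I n] for n <= N gives a finite family that allows cancelling
    the leading term of any element of I. *)
Theorem hilbert_basis : noetherian R -> noetherian {poly R}.
Proof.
move=> nR I II.
have lift n (s : seq R) : (forall c, c \in s -> lead_ideal I n c) ->
    exists2 G : seq {poly R}, forall g, g \in G -> I g &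
      forall c, c \in s -> lead_ideal (gen_ideal (fun g => g \in G)) n c.
  elim: s => [|a s IH] sL; first by exists [::].
  have [|G GI Gs] := IH; first by move=> c cs; apply: sL; rewrite inE cs orbT.
  have [f [If sf fa]] := sL a (mem_head _ _); exists (f :: G).
    by move=> g; rewrite inE => /predU1P[->|/GI].
  move=> c; rewrite inE => /predU1P[->|/Gs[g [Gg sg gc]]].
    by exists f; split=> //; apply: gen_ideal_sub; rewrite mem_head.
  by exists g; split=> //; apply: gen_ideal_mono Gg => h hG; rewrite inE hG orbT.
have gens n : exists2 G : seq {poly R}, forall g, g \in G -> I g &
    forall c, lead_ideal I n c -> lead_ideal (gen_ideal (fun g => g \in G)) n c.
  have [s sP] := nR _ (lead_ideal_is_ideal n II).
  have [|G GI Gs] := lift n s; first by move=> c cs; apply/sP/gen_ideal_sub.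
  exists G => // c /sP; apply: gen_ideal_min => //.
  exact/lead_ideal_is_ideal/gen_ideal_is_ideal.
have gens_le N : exists2 G : seq {poly R}, forall g, g \in G -> I g &
    forall n, (n <= N)%N ->
    forall c, lead_ideal I n c -> lead_ideal (gen_ideal (fun g => g \in G)) n c.
  elim: N => [|N [G GI Gs]].
    by have [G GI Gs] := gens 0%N; exists G => // n; rewrite leqn0 => /eqP ->.
  have [G' GI' Gs'] := gens N.+1; exists (G ++ G').
    by move=> g; rewrite mem_cat => /orP[/GI|/GI'].
  move=> n; rewrite leq_eqVlt => /predU1P[->|nN] c.
    move=> /Gs'[g [Gg sg gc]]; exists g; split=> //.
    by apply: gen_ideal_mono Gg => h hG; rewrite mem_cat hG orbT.
  move=> /(Gs n nN)[g [Gg sg gc]]; exists g; split=> //.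
  by apply: gen_ideal_mono Gg => h hG; rewrite mem_cat hG.
pose U c := exists n, lead_ideal I n c.
have UI : is_ideal U.
  split=> [|x y [m Lx] [n Ly]|a x [n Lx]].
    exists 0%N; exact: ideal0 (lead_ideal_is_ideal _ II).
  - exists (m + n)%N; apply: (idealD (lead_ideal_is_ideal _ II)).
      exact: lead_ideal_mono (leq_addr _ _) Lx.
    exact: lead_ideal_mono (leq_addl _ _) Ly.
  by exists n; apply: (idealM _ (lead_ideal_is_ideal _ II)).
have [N UN] : exists N, forall c, U c -> lead_ideal I N c.
  have [s sP] := nR _ UI.
  suff [N sN] : exists N, forall c, c \in s -> lead_ideal I N c.
    by exists N => c /sP; apply: gen_ideal_min => //; apply: lead_ideal_is_ideal.
  have : forall c, c \in s -> U c by move=> c cs; apply/sP/gen_ideal_sub.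
  elim: s {sP} => [|a s IH] sU; first by exists 0%N.
  have [|N sN] := IH; first by move=> c cs; apply: sU; rewrite inE cs orbT.
  have [m La] := sU a (mem_head _ _); exists (m + N)%N => c.
  rewrite inE => /predU1P[->|/sN Lc]; first exact: lead_ideal_mono (leq_addr _ _) La.
  exact: lead_ideal_mono (leq_addl _ _) Lc.
have [G GI Gs] := gens_le N; exists G => f; split; last exact: gen_ideal_min.
have GG := gen_ideal_is_ideal (fun g => g \in G).
have [k] := ubnP (size f); elim: k f => // k IH f; rewrite ltnS => sf If.
case: k sf IH => [|k] sf IH.
  by move: sf; rewrite leqn0 size_poly_eq0 => /eqP ->; apply: ideal0.
have Lf : lead_ideal I k f`_k by exists f.
have [h [Gh sh hk]] : lead_ideal (gen_ideal (fun g => g \in G)) k f`_k.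
  have [kN|/ltnW Nk] := leqP k N; first exact: Gs.
  by apply: lead_ideal_mono Nk _ => //; apply: (Gs N) => //; apply: UN; exists k.
rewrite -(subrK h f); apply: idealD => //; apply: IH.
  rewrite ltnS; apply/leq_sizeP => j; rewrite leq_eqVlt => /predU1P[<-|kj].
    by rewrite coefB hk subrr.
  by rewrite coefB !nth_default ?subrr // (leq_trans _ kj).
apply: idealB => //; exact: (gen_ideal_min II GI).
Qed.

End HilbertBasis.

Lemma ipoly_noetherian (K : fieldType) n : noetherian (ipoly K n).
Proof. by elim: n => [|n IH]; [exact: noetherian_field | exact: hilbert_basis]. Qed.

Section LocalizationMap.
Variables (A : comPzRingType) (p : prime_ideal A).

Definition to_loc (a : A) : localization p := Defs.frac a (den1 p).

Let p1 : ~ p 1. Proof. by have [] := prime_ideal_prime p. Qed.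

Lemma to_loc_eq0 a : to_loc a = 0 <-> exists w, ~ p w /\ w * a = 0.
Proof.
have -> : (0 : localization p) = Defs.frac 0 (den1 p) by [].
split=> [/fracP|] [w [pw wa]]; last apply/fracP; exists w; split=> //.
  by move: wa; rewrite /= mul0r subr0 mulr1.
by rewrite /= mul0r subr0 mulr1.
Qed.

Let to_locD a b : to_loc (a + b) = to_loc a + to_loc b.
Proof.
by rewrite /to_loc frac_add; apply/fracP; exists 1; split=> //=; ring.
Qed.

Let to_loc_zmod : zmod_morphism to_loc.
Proof. by move=> x y; apply/eqP; rewrite -subr_eq opprK -to_locD subrK. Qed.

Let to_loc_monoid : monoid_morphism to_loc.
Proof.
split=> [//|x y].
by rewrite /to_loc frac_mul; apply/fracP; exists 1; split=> //=; ring.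
Qed.

HB.instance Definition _ := GRing.isZmodMorphism.Build A (localization p) to_loc to_loc_zmod.
HB.instance Definition _ := GRing.isMonoidMorphism.Build A (localization p) to_loc to_loc_monoid.

Lemma to_loc_unit s : ~ p s -> exists v, v * to_loc s = 1.
Proof.
move=> ps; have ps' : `[< ~ p s >] by apply/asboolP.
exists (Defs.frac 1 (Sub s ps')); rewrite /to_loc frac_mul.
have -> : (1 : localization p) = Defs.frac 1 (den1 p) by [].
by apply/fracP; exists 1; split=> //=; ring.
Qed.

Lemma to_loc_frac x : exists s a, ~ p s /\ to_loc s * x = to_loc a.
Proof.
have [a [s ->]] := frac_surj x; exists (val s), a; split.
  by case: s => s ps /=; apply/asboolP.
by rewrite /to_loc frac_mul; apply/fracP; exists 1; split=> //=; ring.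
Qed.

End LocalizationMap.

Section RegularityCriterion.
Variables (B L : comPzRingType) (q : B -> Prop) (phi : {rmorphism B -> L}).

(** L is the localization of B at q, characterized by its fractions rather than
    constructed: this covers a localization of another ring that becomes
    isomorphic to one of B on a chart. *)
Definition is_localization_at : Prop :=
  [/\ forall s, ~ q s -> exists v, v * phi s = 1,
      forall x, exists s b, ~ q s /\ phi s * x = phi b &
      forall b, phi b = 0 -> exists s, ~ q s /\ s * b = 0].

Hypotheses (qp : is_prime q) (locL : is_localization_at).

Let q1 : ~ q 1. Proof. by case: qp. Qed.
Let qI : is_ideal q. Proof. by case: qp. Qed.

Let phi_unit s : ~ q s -> exists v, v * phi s = 1.
Proof. by case: locL => + _ _; apply. Qed.

Let phi_frac x : exists s b, ~ q s /\ phi s * x = phi b.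
Proof. by case: locL => _ + _; apply. Qed.

Let phi_ker b : phi b = 0 -> exists s, ~ q s /\ s * b = 0.
Proof. by case: locL => _ _; apply. Qed.

Definition ext_ideal (Q : B -> Prop) (x : L) : Prop :=
  exists s b, [/\ ~ q s, Q b & phi s * x = phi b].

Lemma ext_ideal_is_ideal Q : is_ideal Q -> is_ideal (ext_ideal Q).
Proof.
move=> QI; split.
- by exists 1, 0; split=> //; [exact: ideal0 QI | rewrite mulr0 rmorph0].
- move=> x y [s [b [qs Qb sx]]] [t [c [qt Qc ty]]].
  exists (s * t), (t * b + s * c); split; first exact: primeM.
    by apply: idealD => //; apply: idealM.
  by rewrite rmorphD !rmorphM -sx -ty; ring.
move=> a x [s [b [qs Qb sx]]]; have [t [c [qt ta]]] := phi_frac a.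
exists (t * s), (c * b); split; [exact: primeM | exact: idealM |].
by rewrite !rmorphM -sx -ta; ring.
Qed.

Lemma ext_ideal_phi Q b : is_prime Q -> (forall x, Q x -> q x) -> ext_ideal Q (phi b) <-> Q b.
Proof.
move=> Qp Qq; split=> [[s [c [qs Qc sb]]]|Qb]; last by exists 1, b; rewrite rmorph1 mul1r.
have [|t [qt tsb]] := @phi_ker (s * b - c); first by rewrite rmorphB rmorphM sb subrr.
have [QI _ _] := Qp; apply: contrapT => nQb.
have nQ x : ~ q x -> ~ Q x by move=> nqx /Qq.
apply: (primeM Qp (nQ _ qt) (primeM Qp (nQ _ qs) nQb)).
have -> : t * (s * b) = t * c by apply/eqP; rewrite -subr_eq0 -mulrBr tsb.
exact: idealM.
Qed.

(** Whether x lies in the extension of Q can be read off any numerator of x; the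
    prime Q has to avoid the denominators. *)
Lemma ext_ideal_frac Q x s b : is_prime Q -> (forall y, Q y -> q y) ->
  ~ q s -> phi s * x = phi b -> ext_ideal Q x <-> Q b.
Proof.
move=> Qp Qq qs sx; split=> [Qx|Qb]; last by exists s, b.
apply/(ext_ideal_phi b Qp Qq); rewrite -sx; apply: idealM => //.
by apply: ext_ideal_is_ideal; case: Qp.
Qed.

Lemma ext_ideal_prime Q : is_prime Q -> (forall x, Q x -> q x) -> is_prime (ext_ideal Q).
Proof.
move=> Qp Qq; have [QI Q1 QM] := Qp; split; first exact: ext_ideal_is_ideal.
  by rewrite -(rmorph1 phi); move/(ext_ideal_phi 1 Qp Qq).
move=> x y; have [s [b [qs sx]]] := phi_frac x; have [t [c [qt ty]]] := phi_frac y.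
have stxy : phi (s * t) * (x * y) = phi (b * c) by rewrite !rmorphM -sx -ty; ring.
rewrite (ext_ideal_frac Qp Qq qs sx) (ext_ideal_frac Qp Qq qt ty).
rewrite (ext_ideal_frac Qp Qq (primeM qp qs qt) stxy); exact: QM.
Qed.

Lemma notin_ext_ideal_unit x : ~ ext_ideal q x -> exists v, v * x = 1.
Proof.
move=> nx; have [s [b [qs sx]]] := phi_frac x.
have [|v vb] := @phi_unit b; last by exists (v * phi s); rewrite -mulrA sx.
by move=> qb; apply: nx; exists s, b.
Qed.

(** Elements outside the extension of q are units, so L is local. *)
Lemma proper_sub_ext_ideal J : is_ideal J -> ~ J 1 -> forall x, J x -> ext_ideal q x.
Proof.
move=> JI J1 x Jx; apply: contrapT => /notin_ext_ideal_unit[v vx]; apply: J1.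
by rewrite -vx; apply: idealM.
Qed.

Lemma ext_ideal_maximal : is_maximal (ext_ideal q).
Proof.
have [mI m1 _] := ext_ideal_prime qp (fun _ => id).
by split=> // J JI J1 _; apply: proper_sub_ext_ideal.
Qed.

Lemma noetherian_localization : noetherian B -> noetherian L.
Proof.
move=> nB I II; have [s sP] := nB _ (is_ideal_preim phi II).
exists (map phi s) => x; split; last first.
  apply: gen_ideal_min => // z /mapP[y ys ->]; apply/(sP y); exact: gen_ideal_sub.
have [t [b [qt tx]]] := phi_frac x; have [v vt] := phi_unit qt => Ix.
rewrite -[x]mul1r -vt -mulrA tx; apply: (idealM _ (gen_ideal_is_ideal _)).
apply: (@gen_ideal_image _ _ phi (fun y => y \in s)) => [y ys|]; first exact: map_f.
by apply/sP; rewrite -tx; apply: idealM.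
Qed.

(** Primes of L correspond to the primes of B inside q, so the chain and the
    bound on chains in B give the Krull dimension h of L, and the h local
    generators of q generate the maximal ideal. *)
Theorem regular_local_criterion h :
  noetherian B -> local_gens q h -> top_chain q h ->
  (forall r c, nat_chain r c -> (forall x, c r x -> q x) -> (r <= h)%N) ->
  regular_local L.
Proof.
move=> nB [s [sq gs]] [c cc cq] bound; split; first exact: noetherian_localization.
have mmax := ext_ideal_maximal; have [mI m1 _] := mmax.
exists (ext_ideal q); split=> // [m' [mI' m1' mmax'] x|].
  split; first exact: proper_sub_ext_ideal.
  by apply: mmax' => // y; apply: proper_sub_ext_ideal.
exists h; split; first split.
- exists (fun i : 'I_h.+1 => ext_ideal (c i)); apply: (@nat_chain_prime_chain L h (fun i => ext_ideal (c i))).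
  have cqi i x : (i <= h)%N -> c i x -> q x.
    by move=> ih cix; apply: cq; apply: (nat_chain_mono cc) cix; rewrite ih leqnn.
  have [cp cS] := cc; split=> [i ih|i ih].
    by apply: ext_ideal_prime (cp i ih) _ => x; apply: cqi.
  have [ci [x [cx ncx]]] := cS i ih; split=> [y [t [b [qt cb ty]]]|].
    by exists t, b; split=> //; apply: ci.
  exists (phi x); split; first by exists 1, x; rewrite rmorph1 mul1r.
  by apply: contra_not ncx => /(ext_ideal_phi x (cp i (ltnW ih)) (fun y => @cqi i y (ltnW ih))).
- move=> e p pc; have [Pp PS] := prime_chain_nat_chain pc.
  apply: (bound _ (fun i x => p (inord i) (phi x))).
    split=> [i ie|i ie]; first exact: (is_prime_preim phi (Pp i ie)).
    have [pi [x [px npx]]] := PS i ie; split=> [y|]; first exact: pi.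
    have [t [b [qt tx]]] := phi_frac x; exists b; rewrite -tx.
    have [[iI _ _] [i1I _ _]] := (Pp i (ltnW ie), Pp i.+1 ie).
    split; first exact: idealM.
    move=> ptx; apply: npx; have [v vt] := phi_unit qt.
    by rewrite -[x]mul1r -vt -mulrA; apply: idealM.
  move=> x px; have [pI p1 _] := Pp e (leqnn e).
  have := proper_sub_ext_ideal pI p1 px.
  by move/(ext_ideal_phi x qp (fun _ => id)).
exists [tuple of map phi s] => x; split; last first.
  apply: gen_ideal_min => // z /mapP[y ys ->].
  by exists 1, y; rewrite rmorph1 mul1r; split=> //; apply: sq.
move=> [t [b [qt qb tx]]]; have [u qu Iu] := gs b qb.
have [v vt] := phi_unit (primeM qp qu qt).
rewrite -[x]mul1r -vt -mulrA rmorphM -mulrA tx -rmorphM.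
apply: (idealM _ (gen_ideal_is_ideal _)).
apply: gen_ideal_image Iu => y ys; exact: map_f.
Qed.

End RegularityCriterion.

Theorem ipoly_localization_regular (K : fieldType) n (q : ipoly K n -> Prop)
    (L : comPzRingType) (phi : {rmorphism ipoly K n -> L}) :
  is_prime q -> is_localization_at q phi -> regular_local L.
Proof.
move=> qp locL; have [m [h [mh lg tc [e eC eq]]]] := ipoly_prime qp.
apply: (regular_local_criterion qp locL (@ipoly_noetherian K n) lg tc) => r c cc cq.
rewrite -(leq_add2l m) mh; apply: (chain_length_bound cc eC) => Q /cq; exact: eq.
Qed.

Section Charts.
Variables (B A : comPzRingType) (phi : {rmorphism B -> A}) (p : prime_ideal A) (g : B).

(** When g is invertible at p and phi becomes an isomorphism after inverting g,
    the local ring of A at p is the local ring of B at the preimage of p. *)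
Lemma chart_localization :
  ~ p (phi g) -> (forall a, exists k b, phi g ^+ k * a = phi b) ->
  (forall b, phi b = 0 -> b = 0) ->
  is_localization_at (fun b => p (phi b)) (to_loc p \o phi).
Proof.
move=> pg surj inj; have pp := prime_ideal_prime p.
split=> [s|x|b].
- exact: to_loc_unit.
- have [s [a [ps sx]]] := to_loc_frac x.
  have [k [t kt]] := surj s; have [l [b lb]] := surj a.
  exists (g ^+ l * t), (g ^+ k * b).
  split; first by rewrite rmorphM rmorphXn -kt; do ?apply: (primeM pp) => //; apply: primeX.
  have et : phi (g ^+ l * t) = phi g ^+ l * (phi g ^+ k * s) by rewrite rmorphM rmorphXn -kt.
  have eb : phi (g ^+ k * b) = phi g ^+ k * (phi g ^+ l * a) by rewrite rmorphM rmorphXn -lb.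
  by rewrite /= et eb !rmorphM /= -sx; ring.
move=> /to_loc_eq0[w [pw wb]]; have [k [t kt]] := surj w.
exists t; split; first by rewrite -kt; apply: (primeM pp) => //; apply: primeX.
by apply: inj; rewrite rmorphM -kt -mulrA wb mulr0.
Qed.

End Charts.

(** * The algebras of type F_4: base change and rescaling *)

Lemma ord4_ind (P : 'I_4 -> Prop) : P o1 -> P o2 -> P o3 -> P o4 -> forall i, P i.
Proof.
move=> P1 P2 P3 P4 [[|[|[|[|//]]]] i4].
- by rewrite (_ : Ordinal i4 = o1) //; apply: val_inj.
- by rewrite (_ : Ordinal i4 = o2) //; apply: val_inj.
- by rewrite (_ : Ordinal i4 = o3) //; apply: val_inj.
- by rewrite (_ : Ordinal i4 = o4) //; apply: val_inj.
Qed.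

Definition vec4 (T : Type) (a1 a2 a3 a4 : T) (i : 'I_4) : T := nth a1 [:: a1; a2; a3; a4] i.

(** The four relations, for elements of any ring: morphisms out of the algebra
    are exactly the solutions in the target. *)
Definition F4_solution (C : comPzRingType) (c x y : 'I_4 -> C) : Prop :=
  [/\ x o1 * y o1 = c o1 + x o2, x o2 * y o2 = c o2 * x o1 + x o3 ^+ 2,
      x o3 * y o3 = c o3 * x o2 + x o4 & x o4 * y o4 = c o4 * x o3 + 1].

Lemma F4_solution_image (C D : comPzRingType) (g : {rmorphism C -> D}) c x y :
  F4_solution c x y -> F4_solution (g \o c) (g \o x) (g \o y).
Proof.
move=> [r1 r2 r3 r4]; split; rewrite /= -rmorphM.
- by rewrite r1 rmorphD.
- by rewrite r2 rmorphD rmorphM rmorphXn.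
- by rewrite r3 rmorphD rmorphM.
- by rewrite r4 rmorphD rmorphM rmorph1.
Qed.

Section F4Universal.
Variables (R : comNzRingType) (c : 'I_4 -> R).
Notation A := (F4_algebra c).

Definition F4x (i : 'I_4) : A := qpi (F4_rel c) 'X_(lshift 4 i).
Definition F4y (i : 'I_4) : A := qpi (F4_rel c) 'X_(rshift 4 i).

Lemma F4_relations : F4_solution (fun i => F4_str c (c i)) F4x F4y.
Proof.
have rel a b d : F4_rel c (a - b - d) -> qpi (F4_rel c) a = qpi (F4_rel c) b + qpi (F4_rel c) d.
  move=> H; rewrite -rmorphD; apply/qpiP/gen_ideal_sub.
  by rewrite opprD addrA.
rewrite /F4x /F4y /F4_str /=; split.
- by rewrite -rmorphM; apply: rel; rewrite /F4_rel !inE eqxx.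
- by rewrite -!rmorphM -rmorphXn; apply: rel; rewrite /F4_rel !inE eqxx orbT.
- by rewrite -!rmorphM; apply: rel; rewrite /F4_rel !inE eqxx !orbT.
- by rewrite -!rmorphM -(rmorph1 (qpi (F4_rel c))); apply: rel; rewrite /F4_rel !inE eqxx !orbT.
Qed.

Lemma F4_ind (P : A -> Prop) :
  (forall r, P (F4_str c r)) -> (forall i, P (F4x i)) -> (forall i, P (F4y i)) ->
  (forall a b, P a -> P b -> P (a + b)) -> (forall a b, P a -> P b -> P (a * b)) ->
  forall a, P a.
Proof.
move=> PC Px Py PD PM a; have [f ->] := qpi_surj a.
apply: (mpoly_subring_ind (P := fun f => P (qpi (F4_rel c) f))) => [r|i|p q|p q].
- exact: PC.
- rewrite -(splitK i); case: (split i) => j; [exact: Px | exact: Py].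
- by rewrite rmorphD; apply: PD.
- by rewrite rmorphM; apply: PM.
Qed.

Variable C : comPzRingType.

Lemma F4_lift (f : {rmorphism R -> C}) (x y : 'I_4 -> C) :
  F4_solution (f \o c) x y ->
  exists e : {rmorphism A -> C},
    [/\ forall r, e (F4_str c r) = f r, forall i, e (F4x i) = x i & forall i, e (F4y i) = y i].
Proof.
move=> [r1 r2 r3 r4].
pose v (j : 'I_(4 + 4)) := match split j with inl i => x i | inr i => y i end.
have vl i : v (lshift 4 i) = x i by rewrite /v (unsplitK (inl i)).
have vr i : v (rshift 4 i) = y i by rewrite /v (unsplitK (inr i)).
have [e eC eX] := mpoly_eval_exists f v.
have [|e' e'E] := @qring_lift C _ (F4_rel c) e.
  move=> P; rewrite /F4_rel !inE => /or4P[] /eqP ->;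
    rewrite !rmorphB !rmorphM ?rmorphXn ?rmorph1 !eC !eX !vl !vr.
  - by rewrite r1 /=; ring.
  - by rewrite r2 /=; ring.
  - by rewrite r3 /=; ring.
  - by rewrite r4 /=; ring.
exists e'; split=> [r|i|i]; first by rewrite e'E eC.
  by rewrite e'E eX vl.
by rewrite e'E eX vr.
Qed.

Lemma F4_rmorph_eq (e e' : {rmorphism A -> C}) :
  (forall r, e (F4_str c r) = e' (F4_str c r)) -> (forall i, e (F4x i) = e' (F4x i)) ->
  (forall i, e (F4y i) = e' (F4y i)) -> e =1 e'.
Proof.
move=> eC ex ey; apply: F4_ind => // a b ea eb; first by rewrite !rmorphD ea eb.
by rewrite !rmorphM ea eb.
Qed.

End F4Universal.

Lemma F4_base_change (R R' : comNzRingType) (f : {rmorphism R -> R'}) (c : 'I_4 -> R)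
    (c' : 'I_4 -> R') : (forall i, c' i = f (c i)) ->
  alg_iso (@tensr _ _ _ (F4_str c : {rmorphism R -> F4_algebra c}) f : {rmorphism _ -> _})
          (F4_str c' : {rmorphism _ -> _}).
Proof.
move=> c'E; set T := tensor _ _.
pose tl : {rmorphism F4_algebra c -> T} := @tensl _ _ _ (F4_str c) f.
pose tr : {rmorphism R' -> T} := @tensr _ _ _ (F4_str c) f.
have bal r : tl (F4_str c r) = tr (f r) by apply: tens_bal.
have [|u [uC ux uy]] := @F4_lift R' c' T tr (fun i => tl (F4x c i)) (fun i => tl (F4y c i)).
  have [r1 r2 r3 r4] := F4_solution_image tl (F4_relations c).
  by split; rewrite /= c'E -bal.
have [|h [hC hx hy]] :=
  @F4_lift R c (F4_algebra c') (F4_str c' \o f) (F4x c') (F4y c').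
  by have [r1 r2 r3 r4] := F4_relations c'; split; rewrite /= -?c'E.
have [v [vl vr] _] := @tensor_universal _ _ _ (F4_str c) f _ h (F4_str c') hC.
apply: (@alg_iso_of_inverse _ _ _ _ _ v u) => [r|t|a].
- exact: vr.
- elim/tensor_ind: t => [a|b|a b IHa IHb|a IHa|a b IHa IHb].
  + rewrite vl; apply: (@F4_rmorph_eq _ c T (u \o h) tl) => [r|i|i] /=.
    * by rewrite hC /= uC bal.
    * by rewrite hx ux.
    * by rewrite hy uy.
  + by rewrite vr uC.
  + by rewrite !rmorphD IHa IHb.
  + by rewrite !rmorphN IHa.
  + by rewrite !rmorphM IHa IHb.
apply: (@F4_rmorph_eq _ c' _ (v \o u) idfun) => [r|i|i] /=.
- by rewrite uC vr.
- by rewrite ux vl hx.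
- by rewrite uy vl hy.
Qed.

Section Rescaling.
Variable R : comNzRingType.

(** The substitution x_i = a_i X_i, y_i = b_i Y_i is compatible with the relations
    when the two monomials on each right-hand side are scaled by the same
    factor a_i b_i: the first list of hypotheses handles the monomial with the
    coefficient, the second one the other monomial. *)
Lemma F4_rescale (c d a b : 'I_4 -> R) :
  [/\ a o1 * b o1 * d o1 = c o1, a o2 * b o2 * d o2 = c o2 * a o1,
      a o3 * b o3 * d o3 = c o3 * a o2 & a o4 * b o4 * d o4 = c o4 * a o3] ->
  [/\ a o1 * b o1 = a o2, a o2 * b o2 = a o3 ^+ 2, a o3 * b o3 = a o4 & a o4 * b o4 = 1] ->
  exists e : {rmorphism F4_algebra c -> F4_algebra d},
    [/\ forall r, e (F4_str c r) = F4_str d r,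
        forall i, e (F4x c i) = F4_str d (a i) * F4x d i &
        forall i, e (F4y c i) = F4_str d (b i) * F4y d i].
Proof.
move=> [s1 s2 s3 s4] [t1 t2 t3 t4]; apply: F4_lift; have [r1 r2 r3 r4] := F4_relations d.
have s r1' r2' : F4_str d r1' * F4_str d r2' = F4_str d (r1' * r2') by rewrite rmorphM.
split; rewrite /= mulrACA ?r1 ?r2 ?r3 ?r4 mulrDr ?mulrA !s.
- by rewrite s1 t1.
- by rewrite s2 t2 rmorphXn -s; ring.
- by rewrite s3 t3 -s; ring.
- by rewrite s4 t4 -s mulr1 rmorph1.
Qed.

Lemma F4_strK (c : 'I_4 -> R) r r' z : r * r' = 1 -> F4_str c r * (F4_str c r' * z) = z.
Proof. by move=> rr'; rewrite mulrA -rmorphM rr' rmorph1 mul1r. Qed.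

Lemma F4_rescaleK (c d a b a' b' : 'I_4 -> R)
    (e : {rmorphism F4_algebra c -> F4_algebra d})
    (e' : {rmorphism F4_algebra d -> F4_algebra c}) :
  (forall i, a i * a' i = 1) -> (forall i, b i * b' i = 1) ->
  [/\ forall r, e (F4_str c r) = F4_str d r,
      forall i, e (F4x c i) = F4_str d (a i) * F4x d i &
      forall i, e (F4y c i) = F4_str d (b i) * F4y d i] ->
  [/\ forall r, e' (F4_str d r) = F4_str c r,
      forall i, e' (F4x d i) = F4_str c (a' i) * F4x c i &
      forall i, e' (F4y d i) = F4_str c (b' i) * F4y c i] ->
  cancel e e'.
Proof.
move=> aa' bb' [eC ex ey] [eC' ex' ey'].
have scaled r r' z w w' : r * r' = 1 -> e z = F4_str d r * w -> e' w = F4_str c r' * w' ->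
    e' (e z) = w'.
  move=> rr' ez ew; apply: etrans (congr1 e' ez) _.
  apply: etrans (rmorphM e' _ _) _.
  by apply: etrans (congr2 *%R (eC' r) ew) _; apply: F4_strK.
apply: (@F4_rmorph_eq _ c _ (e' \o e) idfun) => [r|i|i].
- exact: etrans (congr1 e' (eC r)) (eC' r).
- exact: scaled (aa' i) (ex i) (ex' i).
- exact: scaled (bb' i) (ey i) (ey' i).
Qed.

(** The conditions of [F4_rescale] towards the coefficients 1 read
    a_1 b_1 = c_1 = a_2, a_2 b_2 = c_2 a_1 = a_3^2, a_3 b_3 = c_3 a_2 = a_4 and
    a_4 b_4 = c_4 a_3 = 1.  The last one gives a_3, and then all the others are
    determined. *)
Lemma F4_trivial_coefficients (c c' : 'I_4 -> R) : (forall i, c i * c' i = 1) ->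
  alg_iso (F4_str c : {rmorphism _ -> _}) (F4_str (fun=> 1 : R) : {rmorphism _ -> _}).
Proof.
move=> cc'; have c'c i : c' i * c i = 1 by rewrite mulrC.
pose a := vec4 (c' o2 * c' o4 ^+ 2) (c o1) (c' o4) (c o3 * c o1).
pose b := vec4 (c o1 * c o2 * c o4 ^+ 2) (c' o4 ^+ 2 * c' o1) (c o3 * c o1 * c o4) (c' o3 * c' o1).
pose a' := vec4 (c o2 * c o4 ^+ 2) (c' o1) (c o4) (c' o3 * c' o1).
pose b' := vec4 (c' o1 * c' o2 * c' o4 ^+ 2) (c o4 ^+ 2 * c o1) (c' o3 * c' o1 * c' o4) (c o3 * c o1).
(* In each identity below, the two sides differ by a monomial in the u i = 1. *)
pose u i := c i * c' i; have uE i : u i = 1 by apply: cc'.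
have aa' i : a i * a' i = 1.
  elim/ord4_ind: i; rewrite /a /a' /vec4 /=.
  - by transitivity (u o2 * u o4 ^+ 2); [rewrite /u; ring | rewrite !uE; ring].
  - exact: cc'.
  - exact: c'c.
  - by transitivity (u o3 * u o1); [rewrite /u; ring | rewrite !uE; ring].
have bb' i : b i * b' i = 1.
  elim/ord4_ind: i; rewrite /b /b' /vec4 /=.
  - by transitivity (u o1 * u o2 * u o4 ^+ 2); [rewrite /u; ring | rewrite !uE; ring].
  - by transitivity (u o1 * u o4 ^+ 2); [rewrite /u; ring | rewrite !uE; ring].
  - by transitivity (u o3 * u o1 * u o4); [rewrite /u; ring | rewrite !uE; ring].
  - by transitivity (u o3 * u o1); [rewrite /u; ring | rewrite !uE; ring].
have sab : [/\ a o1 * b o1 = c o1, a o2 * b o2 = c' o4 ^+ 2, a o3 * b o3 = c o3 * c o1 &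
               a o4 * b o4 = 1].
  rewrite /a /b /vec4 /=; split.
  - by transitivity (u o2 * u o4 ^+ 2 * c o1); [rewrite /u; ring | rewrite !uE; ring].
  - by transitivity (u o1 * c' o4 ^+ 2); [rewrite /u; ring | rewrite !uE; ring].
  - by transitivity (u o4 * (c o3 * c o1)); [rewrite /u; ring | rewrite !uE; ring].
  - by transitivity (u o3 * u o1); [rewrite /u; ring | rewrite !uE; ring].
have sab' : [/\ a' o1 * b' o1 = c' o1, a' o2 * b' o2 = c o4 ^+ 2,
                a' o3 * b' o3 = c' o3 * c' o1 & a' o4 * b' o4 = 1].
  rewrite /a' /b' /vec4 /=; split.
  - by transitivity (u o2 * u o4 ^+ 2 * c' o1); [rewrite /u; ring | rewrite !uE; ring].
  - by transitivity (u o1 * c o4 ^+ 2); [rewrite /u; ring | rewrite !uE; ring].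
  - by transitivity (u o4 * (c' o3 * c' o1)); [rewrite /u; ring | rewrite !uE; ring].
  - by transitivity (u o3 * u o1); [rewrite /u; ring | rewrite !uE; ring].
have [ab1 ab2 ab3 ab4] := sab; have [ab1' ab2' ab3' ab4'] := sab'.
have [||e eE] := @F4_rescale c (fun=> 1) a b.
- rewrite ab1 ab2 ab3 ab4 !mulr1 /a /vec4 /=; split=> //.
    by transitivity (u o2 * c' o4 ^+ 2); [rewrite uE; ring | rewrite /u; ring].
- by rewrite ab1 ab2 ab3 ab4.
have [||e' eE'] := @F4_rescale (fun=> 1) c a' b'.
- rewrite ab1' ab2' ab3' ab4' !mul1r /a' /vec4 /=; split=> //.
  + by ring.
  + by transitivity (u o3 * c' o1); [rewrite /u; ring | rewrite uE; ring].
- by rewrite ab1' ab2' ab3' ab4'.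
apply: (@alg_iso_of_inverse _ _ _ _ _ e e'); first by case: eE.
  exact: F4_rescaleK aa' bb' eE eE'.
by apply: F4_rescaleK eE' eE => i; rewrite mulrC.
Qed.

End Rescaling.

(** * Charts and regularity *)

(** The algebra with trivial coefficients up to isomorphism: a ring generated by
    a solution of the relations through which all solutions factor.  Arguing
    from this property alone applies at once to the given presentation and to
    the hypersurface. *)
Definition F4_presented (K : fieldType) (A : comPzRingType) (str : {rmorphism K -> A})
    (x y : 'I_4 -> A) : Prop :=
  [/\ F4_solution (fun=> 1) x y,
      forall P : A -> Prop,
        (forall r, P (str r)) -> (forall i, P (x i)) -> (forall i, P (y i)) ->
        (forall a b, P a -> P b -> P (a + b)) -> (forall a b, P a -> P b -> P (a * b)) ->
        forall a, P a &
      forall (C : comPzRingType) (f : {rmorphism K -> C}) (x' y' : 'I_4 -> C),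
        F4_solution (fun=> 1) x' y' -> exists e : {rmorphism A -> C},
        [/\ forall r, e (str r) = f r, forall i, e (x i) = x' i & forall i, e (y i) = y' i]].

Section Charts.
Variables (K : fieldType) (A : comPzRingType) (str : {rmorphism K -> A}).
Variables X Y : 'I_4 -> A.
Hypothesis presA : F4_presented str X Y.

(* B stands for K[z_0, ..., z_3], used through its universal property only. *)
Variables (B : idomainType) (constB : {rmorphism K -> B}) (z : nat -> B).
Hypothesis evalB : forall (C : comPzRingType) (f : {rmorphism K -> C}) (v : nat -> C),
  exists2 e : {rmorphism B -> C},
    forall a, e (constB a) = f a & forall i, (i < 4)%N -> e (z i) = v i.
Hypothesis rmorphB_eq : forall (C : comPzRingType) (e e' : {rmorphism B -> C}),
  (forall a, e (constB a) = e' (constB a)) ->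
  (forall i, (i < 4)%N -> e (z i) = e' (z i)) -> e =1 e'.

Definition coordinate (w : 'I_4 + 'I_4) : A :=
  match w with inl i => X i | inr i => Y i end.

(** B is the polynomial ring on the four coordinates named by w.  The x i are
    polynomial in these coordinates, whereas y i is the fraction N i / g.  The
    relations, cleared of the denominator g, make these fractions a solution
    in the fraction field of B, hence a morphism psi from A to this field whose
    composite with phi is the inclusion of B; so phi is injective. *)
Lemma chart_exists (w : nat -> 'I_4 + 'I_4) (x N : 'I_4 -> B) (g : B) :
  g != 0 ->
  [/\ x o1 * N o1 = g * (1 + x o2), x o2 * N o2 = g * (x o1 + x o3 ^+ 2),
      x o3 * N o3 = g * (x o2 + x o4) & x o4 * N o4 = g * (x o3 + 1)] ->
  (forall j, (j < 4)%N -> match w j with inl i => x i = z j | inr i => N i = g * z j end) ->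
  (forall phi : {rmorphism B -> A},
     (forall j, (j < 4)%N -> phi (z j) = coordinate (w j)) ->
     (forall i, phi (x i) = X i) /\ (forall i, phi (N i) = phi g * Y i)) ->
  exists phi : {rmorphism B -> A},
    [/\ forall i, phi (x i) = X i, forall a, exists k b, phi g ^+ k * a = phi b &
        forall b, phi b = 0 -> b = 0].
Proof.
move=> g0 [n1 n2 n3 n4] wE coords; have [_ gen lift] := presA.
have [phi phiC phiz] := evalB str (fun j => coordinate (w j)).
have [phix phiN] := coords phi phiz.
exists phi; split=> //.
  apply: gen => [r|i|i|a b [k [s ka]] [l [t lb]]|a b [k [s ka]] [l [t lb]]].
  - by exists 0%N, (constB r); rewrite mul1r phiC.
  - by exists 0%N, (x i); rewrite mul1r phix.
  - by exists 1%N, (N i); rewrite phiN.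
  - exists (k + l)%N, (g ^+ l * s + g ^+ k * t).
    by rewrite rmorphD !rmorphM !rmorphXn -ka -lb mulrDr !mulrA -!exprD addnC.
  by exists (k + l)%N, (s * t); rewrite rmorphM -ka -lb exprD mulrACA.
pose iota : {rmorphism B -> {fraction B}} := @tofrac B.
have ig0 : iota g != 0 by rewrite tofrac_eq0.
have [|psi [psiC psiX psiY]] := lift _ (iota \o constB)
    (fun i => iota (x i)) (fun i => iota (N i) / iota g).
  have sol u v t : u * v = g * t -> iota u * (iota v / iota g) = iota t.
    by move=> uv; rewrite mulrA -rmorphM uv rmorphM mulrAC mulfV // mul1r.
  split.
  - by rewrite (sol _ _ _ n1) rmorphD rmorph1.
  - by rewrite (sol _ _ _ n2) rmorphD rmorphXn mul1r.
  - by rewrite (sol _ _ _ n3) rmorphD mul1r.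
  - by rewrite (sol _ _ _ n4) rmorphD rmorph1 mul1r.
have psiphi : psi \o phi =1 iota.
  apply: rmorphB_eq => [a|j j4] /=; first by rewrite phiC psiC.
  rewrite phiz //; have := wE j j4; case: (w j) => i /= e; first by rewrite psiX e.
  by rewrite psiY e rmorphM mulrAC mulfV // mul1r.
move=> b b0; apply/eqP; rewrite -tofrac_eq0; apply/eqP.
by apply: etrans (esym (psiphi b)) _; rewrite /= b0 rmorph0.
Qed.

Lemma neq0_of_value_at_origin (g : B) :
  (forall e : {rmorphism B -> K}, (forall j, (j < 4)%N -> e (z j) = 0) -> e g != 0) -> g != 0.
Proof.
move=> H; have [e _ ez] := evalB (idfun : {rmorphism K -> K}) (fun=> 0).
by apply: contraNneq (H e ez) => ->; rewrite rmorph0.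
Qed.

(** The open set where u does not vanish is open in affine 4-space: phi becomes an
    isomorphism once g, respectively u, is inverted. *)
Definition chart_at (u : A) : Prop :=
  exists (phi : {rmorphism B -> A}) g,
    [/\ phi g = u, forall a, exists k b, phi g ^+ k * a = phi b & forall b, phi b = 0 -> b = 0].

(** Coordinates x_4, y_4, y_3, y_2: relations 4, 3, 2 give x_3, x_2, x_1 and
    relation 1 gives y_1 = (1 + x_2) / x_1. *)
Lemma chart_x1 : chart_at (X o1).
Proof.
pose x3 := z 0 * z 1 - 1; pose x2 := x3 * z 2 - z 0; pose x1 := x2 * z 3 - x3 ^+ 2.
have [[r1 r2 r3 r4] _ _] := presA.
have [|||phi pz|phi [phix surj inj]] := @chart_exists
  (nth (inl o1) [:: inl o4; inr o4; inr o3; inr o2])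
  (vec4 x1 x2 x3 (z 0)) (vec4 (1 + x2) (x1 * z 3) (x1 * z 2) (x1 * z 1)) x1.
- apply: neq0_of_value_at_origin => e ez.
  rewrite /x1 /x2 /x3 !(rmorphB, rmorphXn, rmorphM, rmorph1) !ez //.
  by rewrite !(mul0r, mulr0, sub0r, subr0) sqrrN expr1n oppr_eq0 oner_eq0.
- by rewrite /vec4 /= /x1 /x2 /x3; split; ring.
- by case=> [|[|[|[|//]]]].
- have [/= p0 p1 p2 p3] := And4 (pz 0 isT) (pz 1 isT) (pz 2 isT) (pz 3 isT).
  have e3 : phi x3 = X o3 by rewrite rmorphB rmorphM rmorph1 p0 p1 r4 mul1r addrK.
  have e2 : phi x2 = X o2 by rewrite rmorphB rmorphM e3 p0 p2 r3 mul1r addrK.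
  have e1 : phi x1 = X o1 by rewrite rmorphB rmorphM rmorphXn e2 e3 p3 r2 mul1r addrK.
  split; apply: ord4_ind; rewrite /vec4 /= ?rmorphM ?p1 ?p2 ?p3 ?e1 //.
  by rewrite rmorphD rmorph1 e2 r1.
by exists phi, x1; split=> //; apply: (phix o1).
Qed.

(** Coordinates x_1, y_1, x_3, y_3: relations 1 and 3 give x_2 and x_4, relations
    2 and 4 give y_2 and y_4 with denominators x_2 and x_4. *)
Lemma chart_x2x4 : chart_at (X o2 * X o4).
Proof.
pose x1 := z 0; pose x3 := z 2; pose x2 := x1 * z 1 - 1; pose x4 := x3 * z 3 - x2.
have [[r1 r2 r3 r4] _ _] := presA.
have [|||phi pz|phi [phix surj inj]] := @chart_exists
  (nth (inl o1) [:: inl o1; inr o1; inl o3; inr o3])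
  (vec4 x1 x2 x3 x4)
  (vec4 (x2 * x4 * z 1) (x4 * (x1 + x3 ^+ 2)) (x2 * x4 * z 3) (x2 * (x3 + 1))) (x2 * x4).
- apply: neq0_of_value_at_origin => e ez.
  rewrite rmorphM /x4 /x2 /x3 /x1 !(rmorphB, rmorphXn, rmorphM, rmorph1) !ez //.
  by rewrite !(mul0r, mulr0, sub0r, subr0) opprK mulN1r oppr_eq0 oner_eq0.
- by rewrite /vec4 /= /x4 /x2; split; ring.
- by case=> [|[|[|[|//]]]].
- have [/= p0 p1 p2 p3] := And4 (pz 0 isT) (pz 1 isT) (pz 2 isT) (pz 3 isT).
  have e2 : phi x2 = X o2 by rewrite rmorphB rmorphM rmorph1 p0 p1 r1 addrAC subrr add0r.
  have e4 : phi x4 = X o4 by rewrite rmorphB rmorphM e2 p2 p3 r3 mul1r addrAC subrr add0r.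
  split; apply: ord4_ind; rewrite /vec4 /= ?rmorphM ?p1 ?p3 ?e2 ?e4 //.
    by rewrite rmorphD rmorphXn p0 p2 mulrAC r2 mul1r mulrC.
  by rewrite rmorphD rmorph1 p2 -mulrA r4 mul1r.
by exists phi, (x2 * x4); split=> //; rewrite rmorphM; congr (_ * _); [apply: (phix o2) | apply: (phix o4)].
Qed.

(** Coordinates x_1, y_1, x_4, y_4: relations 1 and 4 give x_2 and x_3, relations
    2 and 3 give y_2 and y_3 with denominators x_2 and x_3. *)
Lemma chart_x2x3 : chart_at (X o2 * X o3).
Proof.
pose x1 := z 0; pose x4 := z 2; pose x2 := x1 * z 1 - 1; pose x3 := x4 * z 3 - 1.
have [[r1 r2 r3 r4] _ _] := presA.
have [|||phi pz|phi [phix surj inj]] := @chart_exists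
  (nth (inl o1) [:: inl o1; inr o1; inl o4; inr o4])
  (vec4 x1 x2 x3 x4)
  (vec4 (x2 * x3 * z 1) (x3 * (x1 + x3 ^+ 2)) (x2 * (x2 + x4)) (x2 * x3 * z 3)) (x2 * x3).
- apply: neq0_of_value_at_origin => e ez.
  rewrite rmorphM /x4 /x2 /x3 /x1 !(rmorphB, rmorphXn, rmorphM, rmorph1) !ez //.
  by rewrite !(mul0r, mulr0, sub0r, subr0) mulrNN mul1r oner_eq0.
- by rewrite /vec4 /= /x3 /x2; split; ring.
- by case=> [|[|[|[|//]]]].
- have [/= p0 p1 p2 p3] := And4 (pz 0 isT) (pz 1 isT) (pz 2 isT) (pz 3 isT).
  have e2 : phi x2 = X o2 by rewrite rmorphB rmorphM rmorph1 p0 p1 r1 addrAC subrr add0r.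
  have e3 : phi x3 = X o3 by rewrite rmorphB rmorphM rmorph1 p2 p3 r4 mul1r addrK.
  split; apply: ord4_ind; rewrite /vec4 /= ?rmorphM ?p1 ?p3 ?e2 ?e3 //.
    by rewrite rmorphD rmorphXn p0 e3 mulrAC r2 mul1r mulrC.
  by rewrite rmorphD e2 p2 -mulrA r3 mul1r.
by exists phi, (x2 * x3); split=> //; rewrite rmorphM; congr (_ * _); [apply: (phix o2) | apply: (phix o3)].
Qed.

(** A prime containing x_1 does not contain x_2 by relation 1; if it also
    contains x_4, it does not contain x_3 by relation 4. *)
Lemma charts_cover (p : A -> Prop) : is_prime p -> exists2 u, ~ p u & chart_at u.
Proof.
move=> pp; have [pI p1 _] := pp; have [[r1 r2 r3 r4] _ _] := presA.
have [px1|] := pselect (p (X o1)); last by exists (X o1) => //; apply: chart_x1.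
have px2 : ~ p (X o2).
  move=> px2; apply: p1; rewrite -[1](addrK (X o2)) -r1.
  by apply: idealB => //; apply: idealMr.
have [px4|px4] := pselect (p (X o4)); last first.
  by exists (X o2 * X o4); [apply: primeM | apply: chart_x2x4].
have px3 : ~ p (X o3).
  move=> px3; apply: p1; rewrite -[1](addKr (1 * X o3)) -r4 addrC mul1r.
  by apply: idealB => //; apply: idealMr.
by exists (X o2 * X o3); [apply: primeM | apply: chart_x2x3].
Qed.

End Charts.

Section Regularity.
Variables (K : fieldType) (A : comPzRingType) (str : {rmorphism K -> A}).
Variables X Y : 'I_4 -> A.
Hypothesis presA : F4_presented str X Y.

Lemma F4_presented_noetherian : noetherian A.
Proof.
have [_ gen _] := presA.
have [e eC eX] := ipoly_eval_exists 8 str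
  (fun j => if (j < 4)%N then X (inord j) else Y (inord (j - 4))).
apply: (noetherian_image (f := e)) (@ipoly_noetherian K 8).
apply: gen => [r|i|i|_ _ [a <-] [b <-]|_ _ [a <-] [b <-]].
- by exists (ipolyC K 8 r).
- exists (ipolyX K 8 i); rewrite eX ?ltn_ord; last exact: ltn_trans (ltn_ord i) _.
  by congr X; apply: val_inj; rewrite /= inordK.
- exists (ipolyX K 8 (4 + i)); rewrite eX ?ltn_add2l // ltnNge leq_addr /=.
  by congr Y; apply: val_inj; rewrite /= addKn inordK.
- by exists (a + b); rewrite rmorphD.
- by exists (a * b); rewrite rmorphM.
Qed.

Theorem F4_presented_regular : regular_ring A.
Proof.
split=> [|p]; first exact: F4_presented_noetherian.
have pp := prime_ideal_prime p.
have [u pu [phi [g [gu surj inj]]]] := charts_cover presA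
  (@ipoly_eval_exists K 4) (@ipoly_rmorph_eq K 4) pp.
rewrite -gu in pu.
exact: ipoly_localization_regular (is_prime_preim phi pp) (chart_localization pu surj inj).
Qed.

End Regularity.

(** * The hypersurface and the families *)

Section Hypersurface.
Variable K : fieldType.

Let x4 : {mpoly K[5]} := 'X_(inord 0).
Let y4 : {mpoly K[5]} := 'X_(inord 1).
Let y3 : {mpoly K[5]} := 'X_(inord 2).
Let y2 : {mpoly K[5]} := 'X_(inord 3).
Let y1 : {mpoly K[5]} := 'X_(inord 4).
Let x3 := x4 * y4 - 1.
Let x2 := x3 * y3 - x4.
Let x1 := x2 * y2 - x3 ^+ 2.

(** Relation 1 after x_3, x_2 and x_1 have been eliminated with relations 4, 3
    and 2. *)
Definition F4_polynomial : {mpoly K[5]} := x1 * y1 - 1 - x2.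
Notation F := F4_polynomial.

(** With all variables but y_1 equal to 0 one has x_1 = -1 and x_2 = 0, so F
    restricts to - y_1 - 1. *)
Lemma F4_polynomial_nonconstant : (1 < msize F)%N.
Proof.
rewrite ltnNge; apply/negP => /msize1_polyC cF.
have ev b : exists2 e : {rmorphism {mpoly K[5]} -> K}, e F = - b - 1 & forall a, e a%:MP = a.
  have [e eC eX] := mpoly_eval_exists (idfun : {rmorphism K -> K})
    (fun i : 'I_5 => if (i == 4 :> nat) then b else 0).
  exists e => //.
  rewrite /F /x1 /x2 /x3 !(rmorphB, rmorphXn, rmorphM, rmorph1) /y1 /y2 /y3 /y4 /x4.
  rewrite !eX !inordK //=; ring.
have [e0 e0F e0C] := ev 0; have [e1 e1F e1C] := ev 1.
have : e0 F = e1 F by rewrite cF e0C e1C.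
rewrite e0F e1F => /(congr1 (fun t => t + 1)); rewrite !subrK oppr0 => /eqP.
by rewrite eq_sym oppr_eq0 oner_eq0.
Qed.

Notation Q := (qring (eq F)).
Let pi : {rmorphism {mpoly K[5]} -> Q} := qpi (eq F).
Let Qstr : {rmorphism K -> Q} := qpi (eq F) \o @mpolyC 5 K.
Let qx : 'I_4 -> Q := vec4 (pi x1) (pi x2) (pi x3) (pi x4).
Let qy : 'I_4 -> Q := vec4 (pi y1) (pi y2) (pi y3) (pi y4).

Lemma hypersurface_solution : F4_solution (fun=> 1) qx qy.
Proof.
have piF : pi x1 * pi y1 = 1 + pi x2.
  have F0 : pi F = 0.
    by rewrite -(rmorph0 pi); apply/qpiP; rewrite subr0; apply: gen_ideal_sub.
  apply/eqP; rewrite -subr_eq0; apply/eqP; apply: etrans F0.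
  by rewrite -rmorphM -(rmorph1 pi) -rmorphD -rmorphB; congr (pi _); rewrite opprD addrA.
rewrite /qx /qy /vec4; split=> //=.
- by rewrite mul1r -rmorphM -rmorphXn -rmorphD; congr (pi _); rewrite /x1 subrK.
- by rewrite mul1r -rmorphM -rmorphD; congr (pi _); rewrite /x2 subrK.
- by rewrite mul1r -rmorphM -(rmorph1 pi) -rmorphD; congr (pi _); rewrite /x3 subrK.
Qed.

Lemma hypersurface_presented : F4_presented Qstr qx qy.
Proof.
split=> [|P PC Px Py PD PM a|C f x y [r1 r2 r3 r4]]; first exact: hypersurface_solution.
  have [q ->] := qpi_surj a.
  apply: (mpoly_subring_ind (P := fun q => P (pi q))) => [r|i|s t|s t].
  - exact: PC.
  - case: i => [[|[|[|[|[|//]]]]] i5].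
    + by rewrite (_ : Ordinal i5 = inord 0); [exact: (Px o4) | apply: val_inj; rewrite /= inordK].
    + by rewrite (_ : Ordinal i5 = inord 1); [exact: (Py o4) | apply: val_inj; rewrite /= inordK].
    + by rewrite (_ : Ordinal i5 = inord 2); [exact: (Py o3) | apply: val_inj; rewrite /= inordK].
    + by rewrite (_ : Ordinal i5 = inord 3); [exact: (Py o2) | apply: val_inj; rewrite /= inordK].
    + by rewrite (_ : Ordinal i5 = inord 4); [exact: (Py o1) | apply: val_inj; rewrite /= inordK].
  - by rewrite rmorphD; apply: PD.
  - by rewrite rmorphM; apply: PM.
have [e eC eX] := mpoly_eval_exists f
  (fun i : 'I_5 => nth (x o4) [:: x o4; y o4; y o3; y o2; y o1] i).
have [ex4 ey4 ey3 ey2] : [/\ e x4 = x o4, e y4 = y o4, e y3 = y o3 & e y2 = y o2].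
  by rewrite /x4 /y4 /y3 /y2 !eX !inordK.
have ey1 : e y1 = y o1 by rewrite /y1 eX inordK.
have ex3 : e x3 = x o3 by rewrite /x3 rmorphB rmorphM rmorph1 ex4 ey4 r4 mul1r addrK.
have ex2 : e x2 = x o2 by rewrite /x2 rmorphB rmorphM ex3 ex4 ey3 r3 mul1r addrK.
have ex1 : e x1 = x o1 by rewrite /x1 rmorphB rmorphXn rmorphM ex2 ex3 ey2 r2 mul1r addrK.
have [|e' e'E] := @qring_lift C _ (eq F) e.
  by move=> _ <-; rewrite /F 2!rmorphB rmorphM rmorph1 ex1 ex2 ey1 r1 addrAC addrK subrr.
exists e'; split=> [r||].
- by rewrite /= e'E eC.
- by apply: ord4_ind; rewrite /qx /vec4 /= e'E.
- by apply: ord4_ind; rewrite /qy /vec4 /= e'E.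
Qed.

End Hypersurface.

Lemma F4_presented_iso (K : fieldType) (A B : comPzRingType) (f : {rmorphism K -> A})
    (g : {rmorphism K -> B}) x y x' y' :
  F4_presented f x y -> F4_presented g x' y' -> alg_iso f g.
Proof.
move=> [sA genA liftA] [sB genB liftB].
have [u [uC ux uy]] := liftA _ g _ _ sB; have [v [vC vx vy]] := liftB _ f _ _ sA.
apply: (alg_iso_of_inverse (u := u) (v := v)) => //.
- by apply: genA => [r|i|i|a b ea eb|a b ea eb];
    rewrite ?uC ?ux ?uy ?vC ?vx ?vy // ?rmorphD ?rmorphM ea eb.
- by apply: genB => [r|i|i|a b ea eb|a b ea eb];
    rewrite ?vC ?vx ?vy ?uC ?ux ?uy // ?rmorphD ?rmorphM ea eb.
Qed.

Lemma A_triv_presented (K : fieldType) :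
  F4_presented (A_triv_str K) (F4x (fun=> 1 : K)) (F4y (fun=> 1 : K)).
Proof.
split; last first.
- move=> C f x y [r1 r2 r3 r4]; apply: (@F4_lift K (fun=> 1) C f).
  by split; rewrite /= rmorph1.
- exact: F4_ind.
have [r1 r2 r3 r4] := F4_relations (fun=> 1 : K).
by split; [rewrite r1 | rewrite r2 | rewrite r3 | rewrite r4]; rewrite rmorph1.
Qed.

Lemma iso_regular_hypersurface_of_A_triv (K : fieldType) (A : comPzRingType)
    (f : {rmorphism K -> A}) : alg_iso f (A_triv_str K) -> iso_regular_hypersurface 5 f.
Proof.
move=> fA; exists (F4_polynomial K); split.
- exact: F4_polynomial_nonconstant.
- exact: F4_presented_regular (hypersurface_presented K).
- apply: alg_iso_trans fA _.
  exact: F4_presented_iso (A_triv_presented K) (hypersurface_presented K).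
Qed.

Lemma laurentX_unit (K : fieldType) i : exists v, laurentX K i * v = 1.
Proof.
exists (qpi (@laurent_rel K) 'X_(rshift 4 i)).
rewrite -[RHS](rmorph1 (qpi (@laurent_rel K))) -rmorphM; apply/qpiP/gen_ideal_sub.
by exists i.
Qed.

Theorem A_prin_trivial_family (K : fieldType) : alg_iso (A_prin_str K) (trivial_family_str K).
Proof.
have [c' cc'] := choice (@laurentX_unit K).
apply: alg_iso_trans (F4_trivial_coefficients cc') _; apply: alg_iso_sym.
by apply: F4_base_change => i; rewrite rmorph1.
Qed.

Section Fibers.
Variables (K : fieldType) (eta : closed_point (laurent K)).

Lemma fiber_iso_A_triv : alg_iso (fiber_str eta) (A_triv_str (residue_field eta)).
Proof.
have [c' cc'] := choice (@laurentX_unit K).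
apply: alg_iso_trans (F4_base_change (c' := fun i => residue eta (laurentX K i)) _) _ => //.
apply: (@F4_trivial_coefficients _ _ (fun i => residue eta (c' i))) => i.
by rewrite -rmorphM cc' rmorph1.
Qed.

Lemma A_triv_at_iso_A_triv : alg_iso (A_triv_at_str eta) (A_triv_str (residue_field eta)).
Proof. by apply: F4_base_change => i; rewrite rmorph1. Qed.

End Fibers.

Theorem proposition6 (K : fieldType) :
  [/\ alg_iso (A_prin_str K) (trivial_family_str K),
      forall eta : closed_point (laurent K),
        alg_iso (fiber_str eta) (A_triv_at_str eta),
      iso_regular_hypersurface 5 (A_triv_str K) &
      forall eta : closed_point (laurent K),
        iso_regular_hypersurface 5 (fiber_str eta)].
Proof.
split=> [|eta||eta].
- exact: A_prin_trivial_family.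
- exact: alg_iso_trans (fiber_iso_A_triv eta) (alg_iso_sym (A_triv_at_iso_A_triv eta)).
- apply: iso_regular_hypersurface_of_A_triv.
  exact: F4_presented_iso (A_triv_presented K) (A_triv_presented K).
- exact: iso_regular_hypersurface_of_A_triv (fiber_iso_A_triv eta).
Qed.
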